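(* The decision problem $\mathsf{CircBFeas}$ (with condition number $\mu_{\mathrm{Bfeas}}$) belongs to $\mathrm{EXP}_{\mathrm{ro}}^{[\mathsf P]}$.
   Context: Let $\mathcal I=\{0,1\}^\infty\times\mathbb R^\infty$ (disjoint unions over all finite dimensions). A decision problem is $(S,\mu)$ with $S\subset\mathcal I$, $\mu:\mathcal I\to[1,\infty]$. For $(u,x)\in\{0,1\}^s\times\mathbb R^n$: $\mathrm{length}(u,x)=s+n$, $\mathrm{size}(u,x)=\mathrm{length}(u,x)+\lceil\log_2\mu(u,x)\rceil$. Finite-precision BSS machine: BSS machine over $\mathbb R$ (divisions preceded by zero tests) with unit roundoff $u_{\mathrm{mach}}\in(0,1)$, precision $k_{\mathrm{mach}}=\lceil\log_2(1/u_{\mathrm{mach}})\rceil$, read-only registers holding $k_{\mathrm{mach}},u_{\mathrm{mach}}$ readable by the program. A $u_{\mathrm{mach}}$-computation replaces each built-in constant, real input value and arithmetic result $z$ by some $z(1+\delta)$, $|\delta|<u_{\mathrm{mach}}$. Discrete data are encoded by reals, operations on them are error-free. $\mathrm{ar\_cost}_M(u,x)$ = number of steps. $(S,\mu)$ is solved with cost $(\mathrm{Arith},\mathrm{Prec})$ (time constructible functions $\mathbb N^2\to\mathbb N$, $\mathbb N\to\mathbb N$) if some machine $M$ satisfies, for every $(u,x)$ with $\mu(u,x)<\infty$: $\mathrm{ar\_cost}_M(u,x)\le\mathrm{Arith}(\mathrm{length}(u,x),k_{\mathrm{mach}})$, and if $k_{\mathrm{mach}}\ge\mathrm{Prec}(\mathrm{size}(u,x))$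 all $u_{\mathrm{mach}}$-computations of $M$ on $(u,x)$ correctly decide whether $(u,x)\in S$. $\mathrm{EXP}_{\mathrm{ro}}^{[\mathsf P]}$ is the class of problems solved with some cost $(\mathrm{Arith},\mathrm{Prec})$ with $\mathrm{Prec}$ polynomially bounded and $\mathrm{Arith}(\mathrm{length}(u,x),\mathrm{Prec}(\mathrm{size}(u,x)))\le a^{\mathrm{size}(u,x)^d}$ for some constants $a>1,d>0$ and all $(u,x)$. Magnitude: $\mathrm{Range}(F_k)=\{0\}\cup\{y: 2^{-2^k}\le|y|\le 2^{2^{k+1}-1}(1-2^{-k-1})\}$; $\mathrm{mgt}(x)=\min\{k\ge1:x\in\mathrm{Range}(F_k)\}$ for $x\in\mathbb R$, $\max_i\mathrm{mgt}(x_i)$ for vectors. Algebraic circuits: connected DAGs with in-degree-0 nodes (inputs $Y_1,\dots,Y_m$ or real constants), in-degree-2 nodes labeled $+,-,\times,/$ (divisions preceded by nonzero tests), in-degree-3 selection nodes, a distinguished output; encoded in $\mathcal I$. The canonical procedure computes $f_{\mathcal C}(y)$, a selection with parents $(\xi,a,b)$ giving $a$ if $\xi<0$, else $b$. $S_{\mathcal C}=\{y:f_{\mathcal C}(y)\ge0\}$. An $\varepsilon$-evaluation of $\mathcal C$ at $y$ is the canonical procedure with every input, constant and arithmetic node value multiplied by some $(1+\delta)$, $|\delta|<\varepsilon$ (selections exact). $\varrho_{\mathrm{eval}}(\mathcal C,y)=\sup\{\varepsilon<1:$ all $\varepsilon$-evaluations of $\mathcal C$ at $y$ give the correct answer to ''$y\in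 S_{\mathcal C}$?''$\}$. $\mathsf{CircBFeas}$: yes-instances are circuits $\mathcal C$ with $S_{\mathcal C}\ne\emptyset$; condition $\mu_{\mathrm{Bfeas}}(\mathcal C)=\max\{1,1/\varrho_{\mathrm{Bfeas}}(\mathcal C)\}$ with $\varrho_{\mathrm{Bfeas}}(\mathcal C)=\sup_{y\in S_{\mathcal C}}\varrho_{\mathrm{eval}}(\mathcal C,y)2^{-\mathrm{mgt}(y)}$ if $S_{\mathcal C}\neq\emptyset$, and $\inf_{y\in\mathbb R^m}\varrho_{\mathrm{eval}}(\mathcal C,y)$ otherwise. *)

(* Defs.v *)
From HB Require Import structures.
From mathcomp Require Import all_boot all_order all_algebra.
From mathcomp Require Import all_classical all_reals all_analysis.

Set Implicit Arguments.
Unset Strict Implicit.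
Unset Printing Implicit Defensive.
Import Order.TTheory GRing.Theory Num.Theory.
Local Open Scope ring_scope.
Local Open Scope classical_set_scope.

(** * Inputs and decision problems *)

(* {0,1}^oo x R^oo, disjoint unions over all finite dimensions. *)
Definition input (R : realType) : Type := (seq bool * seq R)%type.

Definition ilength (R : realType) (i : input R) : nat :=
  (size i.1 + size i.2)%N.

Definition log2 (R : realType) (x : R) : R := ln x / ln 2.

Record decision_problem (R : realType) := DecisionProblem {
  yes : set (input R);
  cond : input R -> \bar R;
  cond_ge1 : forall i, (1 <= cond i)%E }.

(* Only meaningful when [cond P i < +oo]; the ceiling is then nonnegative. *)
Definition isize (R : realType) (P : decision_problem R) (i : input R) : nat :=
  (ilength i + `|Num.ceil (log2 (fine (cond P i)))|)%N.

(** * Finite-precision BSS machines *)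

(* Discrete data (bits, counters, addresses) and real data are kept in separate
   banks: operations on the former are exact, on the latter rounded.  Each bank
   consists of directly named registers and of a memory addressed through
   discrete registers.  The only arithmetic on discrete data is addition and
   truncated subtraction.  There is no instruction writing [kmach] or the unit
   roundoff. *)
Inductive instr (R : realType) : Type :=
| DConst of nat & nat              (* d_i := n *)
| DMove of nat & nat               (* d_i := d_j *)
| DAdd of nat & nat & nat          (* d_i := d_j + d_k *)
| DSub of nat & nat & nat          (* d_i := d_j - d_k, truncated at 0 *)
| DLoad of nat & nat               (* d_i := dmem[d_j] *)
| DStore of nat & nat              (* dmem[d_i] := d_j *)
| DKmach of nat                    (* d_i := k_mach *)
| RConst of nat & R                (* r_i := c *)
| RMove of nat & nat               (* r_i := r_j *)
| RAdd of nat & nat & nat          (* r_i := r_j + r_k *)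
| RSub of nat & nat & nat          (* r_i := r_j - r_k *)
| RMul of nat & nat & nat          (* r_i := r_j * r_k *)
| RDiv of nat & nat & nat & nat    (* if r_k = 0 goto l else r_i := r_j / r_k *)
| RLoad of nat & nat               (* r_i := rmem[d_j] *)
| RStore of nat & nat              (* rmem[d_i] := r_j *)
| ROfD of nat & nat                (* r_i := d_j *)
| RUmach of nat                    (* r_i := u_mach *)
| Jump of nat                      (* goto l *)
| JumpDLt of nat & nat & nat       (* if d_i < d_j goto l *)
| JumpRNeg of nat & nat            (* if r_i < 0 goto l *)
| Halt.
Arguments DConst {R}. Arguments DMove {R}. Arguments DAdd {R}.
Arguments DSub {R}. Arguments DLoad {R}. Arguments DStore {R}.
Arguments DKmach {R}. Arguments RMove {R}. Arguments RAdd {R}.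
Arguments RSub {R}. Arguments RMul {R}. Arguments RDiv {R}.
Arguments RLoad {R}. Arguments RStore {R}. Arguments ROfD {R}.
Arguments RUmach {R}. Arguments Jump {R}. Arguments JumpDLt {R}.
Arguments JumpRNeg {R}. Arguments Halt {R}.

Definition machine (R : realType) : Type := seq (instr R).

Record config (R : realType) := Config {
  pc : nat;
  dreg : nat -> nat;
  rreg : nat -> R;
  dmem : nat -> nat;
  rmem : nat -> R }.

Definition upd (T : Type) (f : nat -> T) (i : nat) (v : T) : nat -> T :=
  fun j => if j == i then v else f j.

Definition kmach (R : realType) (u : R) : nat := `|Num.ceil (log2 u^-1)|%N.

(* Running off the end of the program is halting. *)
Definition cur (R : realType) (M : machine R) (c : config R) : instr R :=
  nth Halt M (pc c).

(* One step of [M], with unit roundoff [u]; [e] is the relative error committed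
   at this step if it loads a constant or does real arithmetic.  Copies, tests
   and everything discrete are exact, and so is using a discrete datum (which
   is itself encoded by a real) as a real. *)
Definition step (R : realType) (u : R) (M : machine R) (e : R) (c : config R)
    : config R :=
  let: Config p d r dm rm := c in
  let setd i v := Config p.+1 (upd d i v) r dm rm in
  let setr i v := Config p.+1 d (upd r i v) dm rm in
  let goto q := Config q d r dm rm in
  match cur M c with
  | DConst i n => setd i n
  | DMove i j => setd i (d j)
  | DAdd i j k => setd i (d j + d k)%N
  | DSub i j k => setd i (d j - d k)%N
  | DLoad i j => setd i (dm (d j))
  | DStore i j => Config p.+1 d r (upd dm (d i) (d j)) rm
  | DKmach i => setd i (kmach u)
  | RConst i a => setr i (a * (1 + e))
  | RMove i j => setr i (r j)
  | RAdd i j k => setr i ((r j + r k) * (1 + e))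
  | RSub i j k => setr i ((r j - r k) * (1 + e))
  | RMul i j k => setr i ((r j * r k) * (1 + e))
  | RDiv i j k l =>
      if r k == 0 then goto l else setr i ((r j / r k) * (1 + e))
  | RLoad i j => setr i (rm (d j))
  | RStore i j => Config p.+1 d r dm (upd rm (d i) (r j))
  | ROfD i j => setr i (d j)%:R
  | RUmach i => setr i u
  | Jump l => goto l
  | JumpDLt i j l => goto (if (d i < d j)%N then l else p.+1)
  | JumpRNeg i l => goto (if r i < 0 then l else p.+1)
  | Halt => c
  end.

(* [e0 i] is the relative error on the i-th real input value.  Initially the
   input is at the start of the memories and d_0, d_1 hold its two lengths. *)
Definition init (R : realType) (e0 : nat -> R) (i : input R) : config R :=
  Config 0 (fun j => nth 0%N [:: size i.1; size i.2] j) (fun=> 0)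
    (fun j => nat_of_bool (nth false i.1 j))
    (fun j => nth 0 i.2 j * (1 + e0 j)).

Fixpoint run (R : realType) (u : R) (M : machine R) (e0 e : nat -> R)
    (i : input R) (t : nat) : config R :=
  if t is t'.+1 then step u M (e t') (run u M e0 e i t') else init e0 i.

Definition halted (R : realType) (M : machine R) (c : config R) : bool :=
  if cur M c is Halt then true else false.

(* The u_mach-computations of [M] on [i] are the sequences [run u M e0 e i] for
   error sequences [e0] and [e] bounded by [u]. *)
Definition roundoff (R : realType) (u : R) (e : nat -> R) : Prop :=
  forall n, `|e n| < u.

Definition accepts (R : realType) (c : config R) : bool := dreg c 0 == 1%N.

(** * Cost and the class EXP_ro^[P] *)

(* [M] outputs the number [n] (in d_0) on input [w] within [T] steps. *)
Definition outputs (R : realType) (M : machine R) (w : seq bool) (n T : nat)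
    : Prop :=
  forall (u : R) (e0 e : nat -> R),
    0 < u -> u < 1 -> roundoff u e0 -> roundoff u e ->
    let c := run u M e0 e (w, [::]) T in halted M c /\ dreg c 0 = n.

(* The value is computed from the argument in unary in time O(value); the [+ 1]
   only serves the value 0. *)
Definition time_constructible (R : realType) (f : nat -> nat) : Prop :=
  exists (M : machine R) (C : nat),
    forall n, outputs M (nseq n true) (f n) (C * (f n + 1)).

Definition time_constructible2 (R : realType) (f : nat -> nat -> nat) : Prop :=
  exists (M : machine R) (C : nat),
    forall n k, outputs M (nseq n true ++ false :: nseq k true)
                  (f n k) (C * (f n k + 1)).

(* As [step] is the identity on halted configurations, being halted at time [t]
   means halting after at most [t] steps. *)
Definition solves (R : realType) (M : machine R) (P : decision_problem R)
    (Arith : nat -> nat -> nat) (Prec : nat -> nat) : Prop :=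
  forall i : input R, (cond P i < +oo)%E ->
  forall (u : R) (e0 e : nat -> R),
    0 < u -> u < 1 -> roundoff u e0 -> roundoff u e ->
    let c := run u M e0 e i (Arith (ilength i) (kmach u)) in
    halted M c /\
    ((Prec (isize P i) <= kmach u)%N -> (accepts c <-> yes P i)).

Definition solved_with_cost (R : realType) (P : decision_problem R)
    (Arith : nat -> nat -> nat) (Prec : nat -> nat) : Prop :=
  [/\ time_constructible2 R Arith, time_constructible R Prec
    & exists M : machine R, solves M P Arith Prec].

Definition poly_bounded (f : nat -> nat) : Prop :=
  exists c d : nat, forall n, (f n <= c * n ^ d + c)%N.

(* Inputs with infinite condition have infinite size, so they are not
   constrained by the exponential bound. *)
Definition EXP_ro_P (R : realType) (P : decision_problem R) : Prop :=
  exists (Arith : nat -> nat -> nat) (Prec : nat -> nat),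
    [/\ solved_with_cost P Arith Prec,
        poly_bounded Prec
      & exists a d : R, [/\ 1 < a, 0 < d
          & forall i : input R, (cond P i < +oo)%E ->
              (Arith (ilength i) (Prec (isize P i)))%:R
                <= a `^ ((isize P i)%:R `^ d)]].

(** * Magnitude *)

Definition in_rangeF (R : realType) (k : nat) (y : R) : bool :=
  (y == 0) ||
  ((2 ^- (2 ^ k) <= `|y|) &&
   (`|y| <= 2 ^+ (2 ^ k.+1 - 1) * (1 - 2 ^- k.+1))).

Lemma mgt_ex (R : realType) (y : R) :
  exists k : nat, (0 < k)%N && in_rangeF k y.
Proof.
have [y0|y0] := eqVneq y 0; first by exists 1%N; rewrite /in_rangeF y0 eqxx.
have yp : 0 < `|y| by rewrite normr_gt0.
pose k := (Num.bound `|y| + Num.bound `|y|^-1).+1.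
have lt_bnd (z : R) (n : nat) : 0 < z -> (Num.bound z <= n)%N -> z <= 2 ^+ n.
  move=> z0 hn; apply/ltW/(lt_le_trans (archi_boundP (ltW z0))).
  by rewrite -natrX ler_nat (leq_trans hn) // ltnW // ltn_expl.
exists k; rewrite /in_rangeF /= (negPf y0) /=; apply/andP; split.
  rewrite -[leRHS]invrK lef_pV2 ?posrE ?exprn_gt0 ?invr_gt0 //.
  apply: lt_bnd; first by rewrite invr_gt0.
  by apply: leq_trans (ltnW (ltn_expl k _)) => //; rewrite /k ltnW // ltnS leq_addl.
have h12 : 1 <= 2 * (1 - 2 ^- k.+1) :> R.
  rewrite mulrBr mulr1 lerBrDr -lerBrDl [X in _ <= X](_ : _ = 1); last first.
    by rewrite -[2]/(1 + 1 : R) addrK.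
  rewrite exprS invfM mulrA mulfV // mul1r -exprVn.
  by rewrite exprn_ile1 // ?invr_ge0 // invf_le1 // ler1n.
have -> : (2 ^ k.+1 - 1 = (2 ^ k.+1 - 2).+1)%N.
  by rewrite -subSn // expnS -{1}[2%N]muln1 leq_mul // expn_gt0.
rewrite exprSr -mulrA; apply: le_trans (ler_peMr _ h12) => //.
apply: lt_bnd => //.
rewrite (@leq_trans (2 ^ k)) //; last first.
  rewrite expnS mul2n -addnn -addnBA ?leq_addr //.
  by rewrite -{1}[2%N]expn1 leq_exp2l.
by apply: leq_trans (ltnW (ltn_expl k _)) => //; rewrite /k ltnW // ltnS leq_addr.
Qed.

Definition mgt (R : realType) (y : R) : nat := ex_minn (mgt_ex y).

Definition mgtv (R : realType) (m : nat) (y : m.-tuple R) : nat :=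
  \max_(j < m) mgt (tnth y j).

(** * Algebraic circuits *)

Inductive arith_op := Add | Sub | Mul | Div.

Definition ap (R : realType) (o : arith_op) (x y : R) : R :=
  match o with
  | Add => x + y
  | Sub => x - y
  | Mul => x * y
  | Div => (* the preceding zero test; x / y is only used when it succeeds *)
           if y == 0 then 0 else x / y
  end.

Inductive gate (R : realType) : Type :=
| GInput
| GConst of R
| GArith of arith_op & nat & nat
| GSel of nat & nat & nat.
Arguments GInput {R}. Arguments GArith {R}. Arguments GSel {R}.

Definition parents (R : realType) (g : gate R) : seq nat :=
  match g with
  | GInput | GConst _ => [::]
  | GArith _ a b => [:: a; b]
  | GSel x a b => [:: x; a; b]
  end.

(* The nodes are listed in a topological order, and the variables Y_1, ..., Y_m
   are the input nodes in their order of appearance. *)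
Record circuit (R : realType) := Circuit {
  gates : seq (gate R);
  out : nat }.

Definition acyclic (R : realType) (C : circuit R) : bool :=
  [forall i : 'I_(size (gates C)),
     all (fun p => p < i)%N (parents (nth GInput (gates C) i))].

Definition adj (R : realType) (C : circuit R) : rel 'I_(size (gates C)) :=
  fun i j => (val i \in parents (nth GInput (gates C) j))
          || (val j \in parents (nth GInput (gates C) i)).

Definition wf_circuit (R : realType) (C : circuit R) : bool :=
  [&& acyclic C, (out C < size (gates C))%N
    & [forall i, forall j, connect (@adj R C) i j]].

Definition is_input (R : realType) (g : gate R) : bool :=
  if g is GInput then true else false.

Definition ninputs (R : realType) (C : circuit R) : nat :=
  count (@is_input R) (gates C).

(** Evaluation *)

(* [vals] are the values of the preceding nodes, [j] the number of input nodes
   among them, and [e] the relative error at the node. *)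
Definition gate_val (R : realType) (y : seq R) (e : R) (j : nat)
    (vals : seq R) (g : gate R) : R :=
  match g with
  | GInput => y`_j * (1 + e)
  | GConst c => c * (1 + e)
  | GArith o a b => ap o vals`_a vals`_b * (1 + e)
  | GSel x a b => if vals`_x < 0 then vals`_a else vals`_b
  end.

Fixpoint eval_gates (R : realType) (y : seq R) (e : nat -> R) (j : nat)
    (vals : seq R) (gs : seq (gate R)) : seq R :=
  if gs is g :: gs' then
    eval_gates y e (j + is_input g)%N
      (rcons vals (gate_val y (e (size vals)) j vals g)) gs'
  else vals.

(* [e k] is the relative error at the k-th node. *)
Definition eval (R : realType) (C : circuit R) (e : nat -> R)
    (y : (ninputs C).-tuple R) : R :=
  (eval_gates y e 0 [::] (gates C))`_(out C).

Definition fC (R : realType) (C : circuit R) (y : (ninputs C).-tuple R) : R :=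
  eval (fun=> 0) y.

Definition feas (R : realType) (C : circuit R) : set ((ninputs C).-tuple R) :=
  [set y | 0 <= fC y].

(** Condition *)

Definition rho_eval (R : realType) (C : circuit R) (y : (ninputs C).-tuple R)
    : R :=
  sup [set eps : R | 0 <= eps < 1 /\
    forall e : nat -> R, roundoff eps e -> (0 <= eval e y) = (0 <= fC y)].

Definition rho_Bfeas (R : realType) (C : circuit R) : R :=
  if `[< @feas R C !=set0 >]
  then sup [set rho_eval y * 2 ^- mgtv y | y in @feas R C]
  else inf [set rho_eval y | y in [set: (ninputs C).-tuple R]].

(* The inverse of 0 is +oo in [\bar R]. *)
Definition mu_Bfeas (R : realType) (C : circuit R) : \bar R :=
  maxe 1%E ((rho_Bfeas C)%:E^-1)%E.

(** Encoding *)

(* A node is described by numbers, which are written in unary, and the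
   constants form the real part of the input.  Unary and binary node names give
   polynomially related lengths, since every node is listed. *)
Definition op_tag (o : arith_op) : nat :=
  match o with Add => 2 | Sub => 3 | Mul => 4 | Div => 5 end.

Definition gate_word (R : realType) (g : gate R) : seq nat :=
  match g with
  | GInput => [:: 0%N]
  | GConst _ => [:: 1%N]
  | GArith o a b => [:: op_tag o; a; b]
  | GSel x a b => [:: 6; x; a; b]
  end.

Definition gate_const (R : realType) (g : gate R) : seq R :=
  if g is GConst c then [:: c] else [::].

Definition unary (n : nat) : seq bool := rcons (nseq n true) false.

Definition encode (R : realType) (C : circuit R) : input R :=
  (flatten (map unary (out C :: flatten (map (@gate_word R) (gates C)))),
   flatten (map (@gate_const R) (gates C))).

Lemma unary_flatten_inj : injective (fun s => flatten (map unary s)).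
Proof.
have unary_inj2 n : forall m s t,
    unary n ++ s = unary m ++ t -> n = m /\ s = t.
  elim: n => [|n IH] [|m] s t //=; first by case.
  by case=> /IH [-> ->].
elim=> [|n s IH] [|m t] //=.
- by case: m.
- by case: n.
- by move=> /unary_inj2 [-> /IH ->].
Qed.

Lemma encode_inj (R : realType) : injective (@encode R).
Proof.
case=> [g o] [g' o'] E.
have [-> Ew] : o = o' /\ flatten (map (@gate_word R) g)
                        = flatten (map (@gate_word R) g').
  by have /unary_flatten_inj[] := congr1 fst E.
have {E} /= Ec := congr1 snd E; congr Circuit.
elim: g g' Ew Ec => [|a g IH] [|b g'] //=.
- by case: b => // -[].
- by case: a => // -[].
case: a => [|c|[]p q|x p q]; case: b => [|c'|[]p' q'|x' p' q'] //=.
all: try by move=> [] *; subst; congr (_ :: _); auto.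
by move=> [Ew] [-> Ec]; congr (_ :: _); auto.
Qed.

(** * The problem CircBFeas *)

(* This is [mu_Bfeas C] at [encode C] and +oo, the infimum of the empty set, at
   the inputs which are not codes of circuits: those are not instances. *)
Definition CircBFeas_cond (R : realType) (i : input R) : \bar R :=
  ereal_inf [set mu_Bfeas C | C in [set C | wf_circuit C /\ encode C = i]].

Lemma CircBFeas_cond_ge1 (R : realType) (i : input R) :
  (1 <= CircBFeas_cond i)%E.
Proof. by apply: le_ereal_inf_tmp => _ [C _ <-]; rewrite le_max lexx. Qed.

Lemma CircBFeas_condE (R : realType) (C : circuit R) :
  wf_circuit C -> CircBFeas_cond (encode C) = mu_Bfeas C.
Proof.
move=> wC; rewrite /CircBFeas_cond [X in image X _](_ : _ = [set C]).
  by rewrite image_set1 ereal_inf1.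
by apply/seteqP; split=> [D [_ /encode_inj]|_ ->].
Qed.

Lemma CircBFeas_cond_notin (R : realType) (i : input R) :
  (forall C, wf_circuit C -> encode C <> i) -> CircBFeas_cond i = +oo%E.
Proof.
move=> ni; rewrite /CircBFeas_cond [X in image X _](_ : _ = set0).
  by rewrite image_set0 ereal_inf0.
by apply/seteqP; split=> [C [/ni]|].
Qed.

Definition CircBFeas (R : realType) : decision_problem R :=
  @DecisionProblem R
    [set i | exists C : circuit R,
       [/\ wf_circuit C, encode C = i & @feas R C !=set0]]
    (@CircBFeas_cond R) (@CircBFeas_cond_ge1 R).

(* Main.v *)
Require Import Defs.
From mathcomp Require Import all_boot all_order all_algebra.
From mathcomp Require Import all_classical all_reals all_analysis.
From mathcomp Require Import zify ring lra.

(* Two facts make a brute-force search over a grid of points work.  If the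
   instance is infeasible, then at every point whatsoever an evaluation with
   roundoff below the condition gives the right answer "negative".  If it is
   feasible, then there is a witness y of small magnitude at which all
   eps-evaluations are right for some eps that is not too small; as the first
   thing an eps-evaluation does is to perturb its inputs relatively, evaluating
   with roundoff u << eps at any point relatively close to y is an
   eps-evaluation at y.  The grid values 0, +-a_j, +-b_j are obtained from
   a_0 = b_0 = 1 by multiplying repeatedly with 1 + 8u, resp. 1 - 8u.  Although
   the roundoff errors accumulate in the a_j and b_j, the ratio of two
   consecutive ones stays within O(u) of 1, so every real number in a doubly
   exponential range is crossed by the sequence, hence approximated with
   relative error O(u). *)
Set Implicit Arguments.
Unset Strict Implicit.
Unset Printing Implicit Defensive.
Import Order.TTheory GRing.Theory Num.Theory.
Local Open Scope ring_scope.

(** * Structured programs and their correctness *)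

Section Logic.
Variables (R : realType) (u : R).
Implicit Types (M : machine R).

(** An adversary chooses a fresh error below [u] at every step. This form composes without splitting
    error sequences; [must_run] returns to a fixed sequence. *)
Fixpoint must M (T : nat) (Q : config R -> Prop) c : Prop :=
  Q c \/ (if T is T'.+1 then
            forall e, `|e| < u -> must M T' Q (step u M e c) else False).

Lemma must0 M T (Q : config R -> Prop) c : Q c -> must M T Q c.
Proof. by case: T => [|T] /=; left. Qed.

Lemma must_step M T Q c :
  (forall e, `|e| < u -> must M T Q (step u M e c)) -> must M T.+1 Q c.
Proof. by right. Qed.

Lemma must_le M T1 T2 Q c : (T1 <= T2)%N -> must M T1 Q c -> must M T2 Q c.
Proof.
elim: T1 T2 c => [|T1 IH] [|T2] c //=; first by move=> _ [] //; left.
by move=> le [?|H]; [left|right=> e /H; apply: IH].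
Qed.

Lemma must_trans M T1 T2 (P Q : config R -> Prop) c :
  must M T1 P c -> (forall c', P c' -> must M T2 Q c') ->
  must M (T1 + T2) Q c.
Proof.
move=> H PQ; elim: T1 c H => [|T1 IH] c /=; first by case=> // /PQ.
case=> [/PQ|H]; last by right=> e /H /IH.
by apply: must_le (leq_addl T1.+1 T2).
Qed.

Lemma must_impl M T (P Q : config R -> Prop) c :
  must M T P c -> (forall c', P c' -> Q c') -> must M T Q c.
Proof.
move=> H PQ; rewrite -[T]addn0; apply: must_trans H _ => c' /PQ ?.
exact: must0.
Qed.

Lemma must_run M T Q e0 e i t : roundoff u e ->
  must M T Q (run u M e0 e i t) ->
  exists2 t', (t' <= t + T)%N & Q (run u M e0 e i t').
Proof.
move=> re; elim: T t => [|T IH] t /=.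
  by case=> // ?; exists t; rewrite ?addn0.
case=> [?|H]; first by exists t; rewrite ?leq_addr.
by have [t'] := IH t.+1 (H _ (re t)); rewrite addSnnS; exists t'.
Qed.

#[local] Arguments must : simpl never.
#[local] Arguments step : simpl never.

Lemma run_halted M e0 e i t t' : (t <= t')%N ->
  halted M (run u M e0 e i t) ->
  run u M e0 e i t' = run u M e0 e i t.
Proof.
move=> /subnKC <-; elim: (t' - t)%N => [|n IH] h; first by rewrite addn0.
rewrite addnS /= IH //; move: h; rewrite /halted /step.
by case: (run _ _ _ _ _ _) => p d r dm rm; case: (cur _ _).
Qed.

(** * Structured commands, their compilation and a Hoare logic with time budgets *)

Record memory := Memory {
  dr : nat -> nat; rr : nat -> R; dm : nat -> nat; rm : nat -> R }.

Definition conf p (s : memory) : config R :=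
  Config p (dr s) (rr s) (dm s) (rm s).

(** [Quot] is kept apart from [Op] because a division contains a jump; on a zero divisor it falls
    through and leaves the target unchanged. *)
Inductive cmd : Type :=
| Skip
| Op of instr R
| Quot of nat & nat & nat
| Seq of cmd & cmd
| While of nat & nat & cmd
| IfLt of nat & nat & cmd & cmd
| IfNeg of nat & cmd & cmd.

Fixpoint len (c : cmd) : nat :=
  match c with
  | Skip => 0
  | Op _ | Quot _ _ _ => 1
  | Seq a b => len a + len b
  | While _ _ a => (len a).+3
  | IfLt _ _ a b | IfNeg _ a b => (len a + len b).+2
  end.

Fixpoint compile (p : nat) (c : cmd) : machine R :=
  match c with
  | Skip => [::]
  | Op a => [:: a]
  | Quot i j k => [:: RDiv i j k p.+1]
  | Seq a b => compile p a ++ compile (p + len a) b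
  | While i j a =>
      [:: JumpDLt i j p.+2; Jump (p + (len a).+3)] ++
      compile p.+2 a ++ [:: Jump p]
  | IfLt i j a b =>
      JumpDLt i j (p + (len b).+2) :: compile p.+1 b ++
      Jump (p + (len a + len b).+2) :: compile (p + (len b).+2) a
  | IfNeg i a b =>
      JumpRNeg i (p + (len b).+2) :: compile p.+1 b ++
      Jump (p + (len a + len b).+2) :: compile (p + (len b).+2) a
  end.

Lemma size_compile p c : size (compile p c) = len c.
Proof.
elim: c p => [|a|i j k|a IHa b IHb|i j a IHa|i j a IHa b IHb|i a IHa b IHb] p
  //=;
  rewrite !size_cat /= ?IHa ?IHb //; lia.
Qed.

Definition straight (a : instr R) : bool :=
  match a with
  | RDiv _ _ _ _ | Jump _ | JumpDLt _ _ _ | JumpRNeg _ _ | Halt => false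
  | _ => true
  end.

Definition effect (e : R) (a : instr R) (s : memory) : memory :=
  let: Memory d r dm rm := s in
  let setd i v := Memory (upd d i v) r dm rm in
  let setr i v := Memory d (upd r i v) dm rm in
  match a with
  | DConst i n => setd i n
  | DMove i j => setd i (d j)
  | DAdd i j k => setd i (d j + d k)%N
  | DSub i j k => setd i (d j - d k)%N
  | DLoad i j => setd i (dm (d j))
  | DStore i j => Memory d r (upd dm (d i) (d j)) rm
  | DKmach i => setd i (kmach u)
  | RConst i a => setr i (a * (1 + e))
  | RMove i j => setr i (r j)
  | RAdd i j k => setr i ((r j + r k) * (1 + e))
  | RSub i j k => setr i ((r j - r k) * (1 + e))
  | RMul i j k => setr i ((r j * r k) * (1 + e))
  | RLoad i j => setr i (rm (d j))
  | RStore i j => Memory d r dm (upd rm (d i) (r j))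
  | ROfD i j => setr i (d j)%:R
  | RUmach i => setr i u
  | _ => s
  end.

Lemma step_straight M e p s a : nth Halt M p = a -> straight a ->
  step u M e (conf p s) = conf p.+1 (effect e a s).
Proof. by case: s => d r dm rm Ea; rewrite /step /cur /= Ea; case: a Ea. Qed.

Lemma step_jump M e p q s : nth Halt M p = Jump q ->
  step u M e (conf p s) = conf q s.
Proof. by move=> E; rewrite /step /cur /= E. Qed.

Lemma step_jumplt M e p i j q s : nth Halt M p = JumpDLt i j q ->
  step u M e (conf p s) = conf (if (dr s i < dr s j)%N then q else p.+1) s.
Proof. by move=> E; rewrite /step /cur /= E. Qed.

Definition placed M p (c : cmd) :=
  exists2 M1, size M1 = p & exists M2, M = M1 ++ compile p c ++ M2.

(** A weakest precondition with time budget [T]. It ranges over all programs containing the code at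
    [p], because jump targets are absolute. *)
Definition wp (c : cmd) (T : nat) (Q : memory -> Prop) (s : memory) : Prop :=
  forall M p, placed M p c ->
  must M T (fun c' => exists2 s', c' = conf (p + len c) s' & Q s') (conf p s).

Lemma placed_seq M p a b :
  placed M p (Seq a b) -> placed M p a /\ placed M (p + len a) b.
Proof.
case=> M1 s1 [M2 /= ->]; split.
  by exists M1 => //; eexists; rewrite -catA.
exists (M1 ++ compile p a); first by rewrite size_cat s1 size_compile.
by exists M2; rewrite !catA.
Qed.

Lemma placed_nth M p c q : placed M p c -> (q < len c)%N ->
  nth Halt M (p + q) = nth Halt (compile p c) q.
Proof.
case=> M1 s1 [M2 ->] lt.
by rewrite nth_cat s1 ltnNge leq_addr /= addKn nth_cat size_compile lt.
Qed.

Lemma placed_head M p c : placed M p c -> (0 < len c)%N ->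
  nth Halt M p = nth Halt (compile p c) 0.
Proof. by move=> H /(placed_nth H); rewrite addn0. Qed.

Lemma wp_skip T (Q : memory -> Prop) s : Q s -> wp Skip T Q s.
Proof. by move=> Qs M p _; apply: must0; exists s; rewrite ?addn0. Qed.

Lemma wp_le c T1 T2 Q s : (T1 <= T2)%N -> wp c T1 Q s -> wp c T2 Q s.
Proof. by move=> le H M p /H; apply: must_le. Qed.

Lemma wp_impl c T (P Q : memory -> Prop) s :
  wp c T P s -> (forall s', P s' -> Q s') -> wp c T Q s.
Proof.
move=> H PQ M p /H /must_impl; apply=> c' [s' -> /PQ Qs].
by exists s'.
Qed.

Lemma wp_op a (Q : memory -> Prop) s T : straight a ->
  (forall e, `|e| < u -> Q (effect e a s)) -> wp (Op a) T.+1 Q s.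
Proof.
move=> sa H M p /placed_head pl; apply: must_step => e he.
rewrite (step_straight _ _ (a := a)) ?pl //.
by apply: must0; exists (effect e a s); rewrite ?addn1 //; apply: H.
Qed.

Lemma wp_quot i j k (Q : memory -> Prop) s T :
  (rr s k = 0 -> Q s) ->
  (forall e, `|e| < u -> rr s k != 0 ->
     Q (Memory (dr s) (upd (rr s) i (rr s j / rr s k * (1 + e)))
          (dm s) (rm s))) ->
  wp (Quot i j k) T.+1 Q s.
Proof.
move=> H0 H M p /placed_head pl; apply: must_step => e he.
rewrite /step /cur /= pl //=; apply: must0; rewrite addn1.
case: eqP => [/H0|/eqP h]; first by exists s.
by eexists; last exact: H he h.
Qed.

Lemma wp_seq a b T1 T2 Q s :
  wp a T1 (fun s' => wp b T2 Q s') s -> wp (Seq a b) (T1 + T2) Q s.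
Proof.
move=> H M p /placed_seq[pa pb]; apply: must_trans (H _ _ pa) _.
by move=> c' [s' -> /(_ _ _ pb)]; rewrite -addnA.
Qed.

(** Both conditionals are laid out alike, the else branch first, and differ only in their first
    instruction. *)
Lemma placed_branch M p i j a b :
    placed M p (IfLt i j a b) \/ placed M p (IfNeg i a b) ->
  [/\ placed M (p + (len b).+2) a, placed M p.+1 b
    & nth Halt M (p.+1 + len b) = Jump (p + (len a + len b).+2)].
Proof.
move=> H; have {H} [g [M1 s1 [M2 EM]]] : exists g, exists2 M1, size M1 = p &
    exists M2, M = M1 ++ (g :: compile p.+1 b ++
      Jump (p + (len a + len b).+2) :: compile (p + (len b).+2) a) ++ M2.
  by case: H => -[M1 s1 [M2 ->]]; eexists; exists M1 => //; exists M2.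
split.
- exists (M1 ++ g :: compile p.+1 b ++ [:: Jump (p + (len a + len b).+2)]).
    by rewrite size_cat /= size_cat size_compile /=; lia.
  by exists M2; rewrite EM -!catA /= -!catA.
- exists (M1 ++ [:: g]); first by rewrite size_cat /=; lia.
  by rewrite EM; eexists; rewrite -!catA /= -!catA.
rewrite EM nth_cat ltnNge s1 leqW ?leq_addr //= addSnnS addKn /=.
by rewrite -catA nth_cat size_compile ltnn subnn.
Qed.

Lemma must_branch M p a b T Q s (t : bool) :
  [/\ placed M (p + (len b).+2) a, placed M p.+1 b
    & nth Halt M (p.+1 + len b) = Jump (p + (len a + len b).+2)] ->
  (t -> wp a T Q s) -> (~~ t -> wp b T Q s) ->
  must M T.+1
    (fun c => exists2 s', c = conf (p + (len a + len b).+2) s' & Q s')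
    (conf (if t then p + (len b).+2 else p.+1) s).
Proof.
move=> [pa pb J] Ha Hb; case: ifPn => [/Ha H|/Hb H].
  apply: must_le (leqnSn _) _; apply: must_impl (H _ _ pa) _ => c' [s' -> ?].
  by exists s' => //; congr conf; lia.
rewrite -[T.+1]addn1; apply: must_trans (H _ _ pb) _ => c' [s' -> ?].
apply: must_step => e _; rewrite (step_jump _ _ J).
by apply: must0; exists s'.
Qed.

Lemma wp_iflt i j a b T Q s :
  ((dr s i < dr s j)%N -> wp a T Q s) ->
  (~~ (dr s i < dr s j)%N -> wp b T Q s) ->
  wp (IfLt i j a b) T.+2 Q s.
Proof.
move=> Ha Hb M p pl; apply: must_step => e _.
rewrite (step_jumplt _ _ (placed_head pl _)) //.
by apply: must_branch Ha Hb; apply: placed_branch; left; exact: pl.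
Qed.

Lemma wp_ifneg i a b T Q s :
  (rr s i < 0 -> wp a T Q s) -> (~~ (rr s i < 0) -> wp b T Q s) ->
  wp (IfNeg i a b) T.+2 Q s.
Proof.
move=> Ha Hb M p pl; apply: must_step => e _.
rewrite /step /cur /= (placed_head pl) //=.
by apply: must_branch Ha Hb; apply: (@placed_branch _ _ i 0); right.
Qed.

(** The invariant is indexed by the rounds completed. A round costs two jumps besides its body, and
    leaving the loop costs two more. *)
Lemma wp_while i j a T n (I : nat -> memory -> Prop) s :
  I 0%N s ->
  (forall k s', (k < n)%N -> I k s' ->
     (dr s' i < dr s' j)%N /\ wp a T (I k.+1) s') ->
  (forall s', I n s' -> (dr s' j <= dr s' i)%N) ->
  wp (While i j a) (n * T.+2 + 2) (I n) s.
Proof.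
move=> I0 Is In M p pl.
have nM q := placed_nth (q := q) pl.
have pa : placed M p.+2 a.
  case: pl => M1 s1 [M2 /= ->].
  exists (M1 ++ [:: JumpDLt i j p.+2; Jump (p + (len a).+3)]).
    by rewrite size_cat /= s1 addn2.
  by exists (Jump p :: M2); rewrite -!catA.
have Jp : nth Halt M p = JumpDLt i j p.+2 by rewrite (placed_head pl).
have Jp1 : nth Halt M p.+1 = Jump (p + (len a).+3) by rewrite -addn1 nM.
have Jp2 : nth Halt M (p.+2 + len a) = Jump p.
  rewrite (_ : (p.+2 + len a = p + (len a).+2)%N); last lia.
  by rewrite nM /= ?nth_cat ?size_compile ?ltnn ?subnn.
suff main r s' : (r <= n)%N -> I (n - r)%N s' -> must M (r * T.+2 + 2)
    (fun c => exists2 s', c = conf (p + (len a).+3) s' & I n s') (conf p s').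
  by apply: main; rewrite ?subnn.
(* Induction on the number [r] of rounds still to come. *)
elim: r s' {s I0} => [|r IH] s len_r Ik.
  rewrite subn0 in Ik; apply: must_step => e _; apply: must_step => e' _.
  apply: must0; exists s => //.
  by rewrite (step_jumplt _ _ Jp) ltnNge In // (step_jump _ _ Jp1).
have [|lt H] := Is _ _ _ Ik; first by lia.
rewrite mulSn -addnA addSn; apply: must_step => e _.
rewrite (step_jumplt _ _ Jp) lt addSnnS.
apply: must_trans (H _ _ pa) _ => c' [s' -> Is'].
rewrite addSn; apply: must_step => e' _.
rewrite (step_jump _ _ Jp2); apply: IH; first exact: ltnW.
by rewrite subnSK in Is'.
Qed.

Definition init_memory (e0 : nat -> R) (i : input R) : memory :=
  let: Config _ d r dm rm := init e0 i in Memory d r dm rm.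

Lemma wp_run c T Q e0 e i T' : (T <= T')%N -> roundoff u e ->
  wp c T Q (init_memory e0 i) ->
  let cf := run u (compile 0 c) e0 e i T' in
  halted (compile 0 c) cf /\ exists2 s, cf = conf (len c) s & Q s.
Proof.
move=> leT re H.
have [|t lt [s Es Qs]] := @must_run (compile 0 c) T
    (fun c' => exists2 s', c' = conf (len c) s' & Q s') e0 e i 0 re.
  apply: (H (compile 0 c) 0%N).
  by exists [::] => //; exists [::]; rewrite cats0.
(* The position behind the code is out of range, where [nth] returns its default [Halt]. *)
have h : halted (compile 0 c) (run u (compile 0 c) e0 e i t).
  by rewrite Es /halted /cur /= nth_default // size_compile.
by rewrite /= (run_halted (leq_trans lt leT) h); split=> //; exists s.
Qed.
End Logic.
Arguments Skip {R}. Arguments Quot {R}.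

Local Open Scope nat_scope.

Local Coercion Op : instr >-> cmd.
Local Notation "a ;; b" := (Seq a b) (at level 60, right associativity).

Section StraightLine.
Variables (R : realType) (u : R).

Lemma updE T (f : nat -> T) i v j : upd f i v j = if j == i then v else f j.
Proof. by []. Qed.

Lemma wp_op_seq a c T (Q : memory R -> Prop) s : straight a ->
  (forall e, (`|e| < u)%R -> wp u c T Q (effect u e a s)) ->
  wp u (Seq (Op a) c) T.+1 Q s.
Proof. by move=> sa H; rewrite -add1n; apply: wp_seq; apply: wp_op. Qed.

End StraightLine.

#[local] Arguments upd {T} f i v j / : simpl nomatch.

Ltac exe := apply: wp_op_seq => [//|? ?]; rewrite /effect /=.
Ltac exe1 := apply: wp_op => [//|? ?]; rewrite /effect /=.

(** * Programs for powers, squares and the two cost functions *)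

Section Programs.
Variables (R : realType) (u : R).

(* Discrete registers: 0, 1 the lengths of the input, 2 the constant 1, 4 the
   base K, 5 the number of rounds, 7 scratch, 8 the address of the table, 9 the
   round, 10 the constant 0, 11 a quotient, 12 the end of the decoded circuit,
   13 a pointer into it, 14, 15 pointers to the next constant and node value,
   16 a tag, 17 an address, 19 one plus the digits still to be consumed, 20 the
   answer, 21, 22 the bounds of the unwritten part of the table.  Real memory
   consists of the constants, the node values and the table of grid values. *)
Definition pow2 i j c : cmd R :=
  DConst i 1 ;; DConst c 0 ;; While c j (DAdd i i i ;; DAdd c c 2).

Definition square i j c : cmd R :=
  DConst i 0 ;; DConst c 0 ;; While c j (DAdd i i j ;; DAdd c c 2).

Definition agree (xs : seq nat) (s s' : memory R) : Prop :=
  [/\ forall x, x \notin xs -> dr s' x = dr s x,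
      rr s' = rr s, dm s' = dm s & rm s' = rm s].

Lemma wp_pow2 i j c s : uniq [:: i; j; c; 2] -> dr s 2 = 1%N ->
  wp u (pow2 i j c) (dr s j * 4 + 2).+2
    (fun s' => dr s' i = (2 ^ dr s j)%N /\ agree [:: i; c] s s') s.
Proof.
rewrite /= !inE !negb_or => /and4P[/and3P[ij ic i2] /andP[jc j2] c2 _] s2.
case: s s2 => d r m v /= s2; exe; exe.
pose I k (s' : memory R) := [/\ dr s' i = (2 ^ k)%N, dr s' c = k
  & agree [:: i; c] (Memory d r m v) s'].
apply: wp_impl (wp_while (I := I) _ _ _) _.
- split=> /=; rewrite ?updE ?eqxx ?(negPf ic) //.
  by split=> //= x; rewrite !inE negb_or !updE => /andP[/negPf-> /negPf->].
- move=> k [d' r' m' v'] lt [/= di dc [/= dx -> -> ->]].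
  have dj : d' j = d j by rewrite dx // !inE negb_or eq_sym ij.
  have d2 : d' 2 = 1%N by rewrite dx // !inE negb_or eq_sym i2 eq_sym c2.
  split; first by rewrite dc dj.
  have i2' : (2 == i) = false by rewrite eq_sym (negPf i2).
  have ci' : (c == i) = false by rewrite eq_sym (negPf ic).
  exe; exe1; split=> /=.
  - by rewrite ?updE ?(negPf ic) ?eqxx di addnn expnS mul2n.
  - by rewrite ?(updE, eqxx, ci', i2') dc d2 addn1.
  split=> //= x xn; rewrite -dx //; move: xn.
  by rewrite !inE negb_or ?updE => /andP[/negPf-> /negPf->].
- move=> s' [_ -> [dx _ _ _]]; rewrite dx //=.
  by rewrite !inE negb_or eq_sym ij.
by move=> s' [].
Qed.

Lemma wp_square i j c s : uniq [:: i; j; c; 2] -> dr s 2 = 1%N ->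
  wp u (square i j c) (dr s j * 4 + 2).+2
    (fun s' => dr s' i = dr s j ^ 2 /\ agree [:: i; c] s s') s.
Proof.
rewrite /= !inE !negb_or => /and4P[/and3P[ij ic i2] /andP[jc j2] c2 _] s2.
case: s s2 => d r m v /= s2; exe; exe.
pose I k (s' : memory R) := [/\ dr s' i = (k * d j)%N, dr s' c = k
  & agree [:: i; c] (Memory d r m v) s'].
apply: wp_impl (wp_while (I := I) _ _ _) _.
- split=> /=; rewrite ?updE ?eqxx ?(negPf ic) //.
  by split=> //= x; rewrite !inE negb_or !updE => /andP[/negPf-> /negPf->].
- move=> k [d' r' m' v'] lt [/= di dc [/= dx -> -> ->]].
  have dj : d' j = d j by rewrite dx // !inE negb_or eq_sym ij.
  have d2 : d' 2 = 1%N by rewrite dx // !inE negb_or eq_sym i2 eq_sym c2.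
  split; first by rewrite dc dj.
  have i2' : (2 == i) = false by rewrite eq_sym (negPf i2).
  have ci' : (c == i) = false by rewrite eq_sym (negPf ic).
  exe; exe1; split=> /=.
  - by rewrite ?updE ?(negPf ic) ?eqxx di dj mulSn addnC.
  - by rewrite ?(updE, eqxx, ci', i2') dc d2 addn1.
  split=> //= x xn; rewrite -dx //; move: xn.
  by rewrite !inE negb_or ?updE => /andP[/negPf-> /negPf->].
- move=> s' [_ -> [dx _ _ _]]; rewrite dx //=.
  by rewrite !inE negb_or eq_sym ij.
by move=> s' [-> _ ?]; rewrite mulnn.
Qed.

(** [n + k + 1] is the length of the word on which constructibility is tested. The factor 8, three
    doublings, makes room for the fifth power of the number of codes searched. *)
Definition arith_bound n k := 2 ^ (8 * (n + k + 1)) ^ 2.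

Definition arith_bound_prog : cmd R :=
  DConst 2 1 ;; DAdd 3 0 0 ;; DAdd 3 3 3 ;; DAdd 3 3 3 ;;
  square 4 3 7 ;; pow2 0 4 7.

Lemma wp_arith_bound s : wp u arith_bound_prog
    (32 * (2 ^ (8 * dr s 0) ^ 2 + 1))
    (fun s' => dr s' 0 = 2 ^ (8 * dr s 0) ^ 2) s.
Proof.
case: s => d r m v; set x := d 0.
suff H : wp u arith_bound_prog
    ((8 * x * 4 + 2).+2 + ((8 * x) ^ 2 * 4 + 2).+2).+4
    (fun s' => dr s' 0 = 2 ^ (8 * x) ^ 2) (Memory d r m v).
  apply: wp_le H; move: (8 * x) => b.
  have le_b : b <= b ^ 2 by rewrite -mulnn; nia.
  have := ltn_expl (b ^ 2) (ltnSn 1).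
  by move: (2 ^ b ^ 2) (b ^ 2) le_b => P q; lia.
exe; exe; exe; exe; rewrite -/x.
have -> : x + x + (x + x) + (x + x + (x + x)) = 8 * x by lia.
apply: wp_seq.
apply: wp_impl.
  by apply: wp_square.
move=> s' [/= d4 [d' _ _ _]].
apply: wp_impl.
  by rewrite -d4; apply: wp_pow2 => //; rewrite d'.
by move=> s'' /= [-> _]; rewrite d4.
Qed.

(** Ten bits beyond the size make the grid error [16 * u] smaller than half the reciprocal of
    [2 ^ n], and force [u] below 1/100. *)
Definition prec_bound n := n + 10.

Definition prec_bound_prog : cmd R := DConst 1 10 ;; DAdd 0 0 1.

Lemma wp_prec_bound s :
  wp u prec_bound_prog 2 (fun s' => dr s' 0 = dr s 0 + 10) s.
Proof. by case: s => d r m v; exe; exe1. Qed.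

End Programs.
Arguments pow2 {R}. Arguments square {R}.

(** * Decoding the circuit *)

Section Parse.
Variables (R : realType) (u : R).

(** The state consists of the numbers completed and the current run of ones; [parse_prog] performs
    one such step per bit. *)
Definition dec_step (acc : seq nat * nat) (b : bool) : seq nat * nat :=
  if b then (acc.1, acc.2.+1) else (rcons acc.1 acc.2, 0).

Definition dec : seq bool -> seq nat * nat := foldl dec_step ([::], 0).

Lemma foldl_dec_unary n acc m :
  foldl dec_step (acc, m) (unary n) = (rcons acc (m + n), 0).
Proof.
elim: n m => [|n IH] m; first by rewrite addn0.
by rewrite /= IH /= addSnnS.
Qed.

Lemma dec_unary ws : dec (flatten (map unary ws)) = (ws, 0).
Proof.
rewrite /dec -[in RHS](cat0s ws); elim: ws [::] => [|n ws IH] acc /=.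
  by rewrite cats0.
by rewrite foldl_cat foldl_dec_unary IH cat_rcons.
Qed.

(** The decoded numbers are written behind the bits, so no unread bit is overwritten. *)
Definition parse_prog : cmd R :=
  DConst 2 1 ;; DConst 10 0 ;; DMove 12 0 ;; DConst 13 0 ;; DConst 16 0 ;;
  While 13 0
    (DLoad 7 13 ;;
     IfLt 10 7 (DAdd 16 16 2) (DStore 12 16 ;; DAdd 12 12 2 ;; DConst 16 0) ;;
     DAdd 13 13 2).

Definition parsed S N (ws : seq nat) (s : memory R) : Prop :=
  [/\ [/\ dr s 0 = S, dr s 1 = N, dr s 2 = 1, dr s 10 = 0
        & dr s 12 = S + size ws]
    & forall i, i < size ws -> dm s (S + i) = nth 0 ws i].

Lemma wp_parse bits ws s : bits = flatten (map unary ws) ->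
  dr s 0 = size bits -> (forall j, dm s j = nth false bits j) ->
  wp u parse_prog (size bits * 9 + 7)
    (fun s' => parsed (size bits) (dr s 1) ws s' /\ rm s' = rm s) s.
Proof.
move=> Ebits; case: s => d r m v /= d0 Em.
rewrite (_ : _ + 7 = (size bits * 9 + 2).+1.+4); last by lia.
exe; exe; exe; exe; exe.
pose I k (s' : memory R) := [/\
  parsed (size bits) (d 1) (dec (take k bits)).1 s',
  [/\ dr s' 13 = k, dr s' 16 = (dec (take k bits)).2 & rm s' = v]
  & forall j, j < size bits -> dm s' j = nth false bits j].
apply: wp_impl (wp_while (I := I) _ _ _) _.
- rewrite /I take0 /dec /parsed /= ?updE /= d0 addn0; split=> //.
- move=> k [d' r' m' v'] lt [[/=[e0 e1 e2 e10 e12] eW] [e13 e16 ->] em].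
  split; first by rewrite e13 e0.
  rewrite /I (take_nth false lt) /dec foldl_rcons -/(dec _).
  have := em _ lt; set b := nth false bits k => eb.
  exe; rewrite e13 eb.
  apply: (@wp_seq _ _ _ _ 5 1); apply: wp_iflt; rewrite /= ?updE /= e10.
  + case: b {eb} => // _.
    exe1; exe1; split=> //=; split; rewrite ?updE //= ?e13 ?e16 ?e2 ?addn1 //.
  + case: b {eb} => // _.
    exe; exe; exe1; exe1; split=> //=; last first.
    * by move=> j lej; rewrite e12 updE ltn_eqF ?em //; lia.
    * by split; rewrite ?updE //= ?e13 ?e2 ?addn1.
    split; rewrite /= ?updE //= ?e12 ?e2 ?size_rcons ?addnS ?addn0 ?addn1 //.
    move=> i lei; rewrite updE eqn_add2l nth_rcons.
    move: lei; rewrite ltnS leq_eqVlt => /predU1P[->|lti].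
      by rewrite eqxx ltnn e16.
    by rewrite ltn_eqF // lti eW.
- by move=> s' [[[-> _ _ _ _] _] [-> _ _] _].
by rewrite /I take_size Ebits dec_unary => s' [? [_ _ ->] _].
Qed.

End Parse.

(** * The grid of real numbers *)

Local Open Scope ring_scope.

Section Grid.
Variables (R : realType) (u : R).
Hypothesis u_gt0 : 0 < u.

Lemma rounded_le (x e : R) : `|e| < u -> 0 <= x ->
  x * (1 - u) <= x * (1 + e) <= x * (1 + u).
Proof.
by rewrite ltr_norml => /andP[e1 e2] x0; rewrite !ler_wpM2l ?andbT; lra.
Qed.

Section Small.
Hypothesis u_le : u <= 100%:R^-1.

(** Rounding the sum costs about [u]; the rounding of [8 * u] and all products of errors are of
    second order and absorbed by the bound on [u]. *)
Lemma grid_ratios (e1 e2 e3 : R) :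
    `|e1| < u -> `|e2| < u -> `|e3| < u ->
  let h := 8%:R * u * (1 + e1) in
  1 + 13%:R / 2 * u <= (1 + h) * (1 + e2) <= 1 + 10 * u /\
  1 - 10 * u <= (1 - h) * (1 + e3) <= 1 - 13%:R / 2 * u.
Proof.
move=> h1 h2 h3 h; have u1 := u_gt0; have u2 := u_le.
have /(rounded_le h1) /andP[l1 l2] : 0 <= 8%:R * u by lra.
rewrite -/h in l1 l2.
have uu : 0 <= u * u <= 100%:R^-1 * u by rewrite mulr_ge0 ?ler_wpM2r; lra.
have uuu : 0 <= u * u * u <= 100%:R^-1 * u.
  by rewrite !mulr_ge0 /=; nra.
have /(rounded_le h2) /andP[k1 k2] : 0 <= 1 + h by nra.
have /(rounded_le h3) /andP[k3 k4] : 0 <= 1 - h by nra.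
by split; apply/andP; split; nra.
Qed.

(** The multiplication costs another [u]. The lower bound drives the growth of the range, the upper
    one its density. *)
Lemma grid_up (a q e : R) : 0 < a -> `|e| < u ->
  1 + 13%:R / 2 * u <= q <= 1 + 10 * u ->
  a * (1 + 5 * u) <= a * q * (1 + e) <= a * (1 + 12 * u).
Proof.
move=> a0 he /andP[q1 q2]; have u1 := u_gt0; have u2 := u_le.
have /(rounded_le he) /andP[k1 k2] : 0 <= q by lra.
by rewrite -!mulrA !ler_pM2l //; apply/andP; split; nra.
Qed.

Lemma grid_down (b q e : R) : 0 < b -> `|e| < u ->
  1 - 10 * u <= q <= 1 - 13%:R / 2 * u ->
  b * (1 - 12 * u) <= b * q * (1 + e) <= b * (1 - 5 * u).
Proof.
move=> b0 he /andP[q1 q2]; have u1 := u_gt0; have u2 := u_le.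
have /(rounded_le he) /andP[k1 k2] : 0 <= q by lra.
by rewrite -!mulrA !ler_pM2l //; apply/andP; split; nra.
Qed.

(** Negation is a rounded subtraction from 0, hence the passage from 12 to 16. *)
Lemma grid_opp (x t e : R) : 0 < t -> `|e| < u -> `|x - t| <= 12 * u * t ->
  `|(0 - x) * (1 + e) - - t| <= 16 * u * t.
Proof.
move=> t0 he; rewrite !ler_norml => /andP[l1 l2].
have u1 := u_gt0; have u2 := u_le.
have : 0 <= x by nra.
move=> /(rounded_le he)/andP[k1 k2].
have ut : 0 < u * t by rewrite mulr_gt0.
by apply/andP; split; nra.
Qed.

Definition covered (G : nat -> R) n (t : R) :=
  exists2 i, (i < n)%N & `|G i - t| <= 16 * u * `|t|.

(** Outside the old range, [|t|] lies either just below [a'] or just above [b']. Each of these is in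
    the table with both signs, which makes four entries per round. *)
Lemma covered_step (G : nat -> R) n (a b a' b' e e' t : R) :
  0 < b -> b <= a -> a' <= a * (1 + 12 * u) -> b * (1 - 12 * u) <= b' ->
  `|e| < u -> `|e'| < u ->
  G n = a' -> G n.+1 = (0 - a') * (1 + e) ->
  G n.+2 = b' -> G n.+3 = (0 - b') * (1 + e') ->
  (b < `|t| < a -> covered G n t) ->
  b' < `|t| < a' -> covered G n.+4 t.
Proof.
move=> b0 ba ha hb he he' Ga Ga1 Gb Gb1 old /andP[l1 l2].
have u1 := u_gt0; have u2 := u_le.
have [la|la] := ltP `|t| a; last first.
  have ap : `|a' - `|t| | <= 12 * u * `|t|.
    have : a * (12 * u) <= `|t| * (12 * u) by rewrite ler_wpM2r //; lra.
    by rewrite [`|_ - _|]ger0_norm; lra.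
  have t0 : 0 < `|t| by apply: lt_le_trans la; apply: lt_le_trans ba.
  have [tp|tn] := leP 0 t.
    exists n; first by rewrite ltnS !leqW.
    by rewrite (ger0_norm tp) in ap t0 *; rewrite Ga; apply: le_trans ap _; nra.
  exists n.+1; first by rewrite !ltnS !leqW.
  by rewrite Ga1 -{1}[t]opprK -{1}(ltr0_norm tn); apply: grid_opp.
have [lb|lb] := ltP b `|t|.
  have [|i lt H] := old; first by rewrite lb la.
  by exists i => //; rewrite (leq_trans lt) // !leqW.
have t0 : 0 < `|t|.
  by apply: le_lt_trans l1; apply: le_trans hb; rewrite mulr_ge0 //; lra.
have ap : `|b' - `|t| | <= 12 * u * `|t|.
  have : `|t| * (1 - 12 * u) <= b * (1 - 12 * u) by rewrite ler_wpM2r //; lra.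
  by rewrite [`|_ - _|]ler0_norm; lra.
have [tp|tn] := leP 0 t.
  exists n.+2; first by rewrite !ltnS !leqW.
  by rewrite (ger0_norm tp) in ap t0 *; rewrite Gb; apply: le_trans ap _; nra.
exists n.+3; first by [].
by rewrite Gb1 -{1}[t]opprK -{1}(ltr0_norm tn); apply: grid_opp.
Qed.

(** The endpoints [a] and [b] are known only up to rounding; the powers say that the range grows
    geometrically. In the table four entries precede the first round, one of them serving as the
    grid value 0. *)
Definition grid (G : nat -> R) k (a b : R) :=
  [/\ (1 + 5%:R * u) ^+ k <= a, 0 < b, b * (1 + 5%:R * u) ^+ k <= 1
    & forall t, b < `|t| < a -> covered G (4 * k.+1) t].

Lemma grid_step (G G' : nat -> R) k (a b qa qb e1 e2 e3 e4 : R) :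
  1 + 13%:R / 2 * u <= qa <= 1 + 10 * u ->
  1 - 10 * u <= qb <= 1 - 13%:R / 2 * u ->
  `|e1| < u -> `|e2| < u -> `|e3| < u -> `|e4| < u ->
  let n := (4 * k.+1)%N in
  let a' := a * qa * (1 + e1) in let b' := b * qb * (1 + e2) in
  (forall i, (i < n)%N -> G' i = G i) ->
  G' n = a' -> G' n.+1 = (0 - a') * (1 + e3) ->
  G' n.+2 = b' -> G' n.+3 = (0 - b') * (1 + e4) ->
  grid G k a b -> grid G' k.+1 a' b'.
Proof.
move=> hqa hqb h1 h2 h3 h4 n a' b' old Ga Ga1 Gb Gb1 [ca cb0 cb cc].
have u1 := u_gt0; have u2 := u_le.
have pk : 1 <= (1 + 5 * u) ^+ k by rewrite exprn_ege1 //; lra.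
have a0 : 0 < a by lra.
have /andP[a'1 a'2] := grid_up a0 h1 hqa.
have /andP[b'1 b'2] := grid_down cb0 h2 hqb.
rewrite -/a' in a'1 a'2; rewrite -/b' in b'1 b'2.
split.
- by apply: le_trans a'1; rewrite exprSr ler_wpM2r //; lra.
- by apply: lt_le_trans b'1; rewrite mulr_gt0 //; lra.
- apply: le_trans cb; rewrite exprS mulrA ler_wpM2r //; first lra.
  have : b' * (1 + 5 * u) <= b * (1 - 5 * u) * (1 + 5 * u).
    by rewrite ler_wpM2r //; lra.
  by move/le_trans; apply; rewrite -mulrA ler_piMr ?ltW //; nra.
move=> t tab; rewrite (_ : 4 * k.+2 = n.+4)%N; last by rewrite mulnS add4n.
apply: covered_step cb0 _ a'2 b'1 h3 h4 Ga Ga1 Gb Gb1 _ tab.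
  by apply: le_trans (le_trans pk ca); nra.
by move=> /cc [i lti H]; exists i; rewrite ?old.
Qed.

Lemma grid_covered (G : nat -> R) k (a b t : R) : grid G k a b ->
  (1 + 5%:R * u) ^- k < `|t| < (1 + 5%:R * u) ^+ k -> covered G (4 * k.+1) t.
Proof.
move=> [ca cb0 cb cc] /andP[t1 t2].
apply: cc; rewrite (lt_le_trans t2 ca) andbT; apply: le_lt_trans t1.
have p0 : 0 < (1 + 5%:R * u) ^+ k.
  by have u1 := u_gt0; rewrite exprn_gt0 //; lra.
by rewrite -[leRHS]mul1r ler_pdivlMr.
Qed.
End Small.

Local Open Scope nat_scope.

Definition setup_prog : cmd R :=
  DKmach 3 ;; DAdd 3 3 3 ;; DAdd 3 3 0 ;; DConst 7 2 ;; DAdd 3 3 7 ;;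
  pow2 4 3 7 ;; square 6 3 7 ;; pow2 5 6 7 ;; DAdd 8 0 1.

(** The bits of a table index. [2 * kmach u] provides enough rounds for the required range, and [S]
    bounds the number of inputs, so that [digits S ^ 2] bits hold one index per input. *)
Definition digits S := 2 * kmach u + S + 2.

(** Conditional on a small [u]: the program has to halt in time for every [u], but nothing is
    claimed of the grid when [u] is large. *)
Definition dense_grid S (G : nat -> R) : Prop :=
  (u <= 100%:R^-1)%R -> forall t : R,
    ((1 + 5%:R * u) ^- (2 ^ (digits S - 2)).-1 < `|t| <
       (1 + 5%:R * u) ^+ (2 ^ (digits S - 2)).-1)%R ->
    covered G (2 ^ digits S) t.

Definition ready S N ws (s : memory R) : Prop :=
  parsed S N ws s /\
  [/\ dr s 4 = 2 ^ digits S, dr s 5 = 2 ^ digits S ^ 2 & dr s 8 = S + N].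

Lemma ready_frame S N ws (s s' : memory R) : ready S N ws s ->
  all (fun x => dr s' x == dr s x) [:: 0; 1; 2; 4; 5; 8; 10; 12] ->
  dm s' = dm s -> ready S N ws s'.
Proof.
move=> [[[e0 e1 e2 e10 e12] ew] [e4 e5 e8]] /allP e em.
by split; [split; [split|rewrite em //]|split]; rewrite (eqP (e _ _)).
Qed.

Lemma wp_setup S N ws s : parsed S N ws s ->
  wp u setup_prog (8 * digits S + 4 * digits S ^ 2 + 18)
    (fun s' => ready S N ws s' /\ rm s' = rm s) s.
Proof.
case: s => d r m v [/= [d0 d1 d2 d10 d12] em].
set X := digits S.
rewrite (_ : _ + 18 =
  ((X * 4 + 2).+2 + ((X * 4 + 2).+2 + ((X ^ 2 * 4 + 2).+2 + 1))).+1.+4);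
  last lia.
exe; exe; exe; exe; exe.
have -> : kmach u + kmach u + d 0 + 2 = X by rewrite /X /digits d0; lia.
apply: wp_seq; apply: wp_impl; first by apply: wp_pow2.
move=> [d1' r1 m1 v1] /= [e4 [/= dx _ -> ->]].
have e3 : d1' 3 = X by rewrite dx.
apply: wp_seq; apply: wp_impl.
  by rewrite -e3; apply: wp_square => //=; rewrite dx.
move=> [d2' r2 m2 v2] /= [e6 [/= dx' _ -> ->]].
have e6' : d2' 6 = X ^ 2 by rewrite e6 e3.
apply: wp_seq; apply: wp_impl.
  rewrite -e6'; apply: wp_pow2 => //=; by rewrite dx' // dx.
move=> [d3' r3 m3 v3] /= [e5 [/= dx'' _ -> ->]].
exe1; split=> //; split.
  split; last exact: em.
  by split; rewrite /= ?updE /= dx'' // dx' // dx //= ?updE.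
split; rewrite /= ?updE /= ?e5 ?e6' ?dx'' // ?dx' // ?e4 ?dx //.
by rewrite ?updE /= ?d0 ?d1.
Qed.

End Grid.

Local Open Scope nat_scope.

Section Table.
Variables (R : realType) (u : R).
Hypothesis u_gt0 : (0 < u)%R.

(** The reals 1, 0 and 8 are converted from discrete registers, which is exact, unlike [RConst].
    Real registers 4 and 5 hold the two ratios, 6 and 7 the current [a] and [b]. Writing starts at
    the fifth entry. *)
Definition table_prog : cmd R :=
  ROfD 9 2 ;; ROfD 8 10 ;; DConst 7 8 ;; ROfD 10 7 ;; RUmach 0 ;;
  RMul 10 10 0 ;; RAdd 4 9 10 ;; RSub 5 9 10 ;; RMove 6 9 ;; RMove 7 9 ;;
  DConst 7 4 ;; DAdd 21 8 7 ;; DAdd 22 8 4 ;;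
  While 21 22
    (RMul 6 6 4 ;; RMul 7 7 5 ;;
     RStore 21 6 ;; DAdd 21 21 2 ;;
     RSub 0 8 6 ;; RStore 21 0 ;; DAdd 21 21 2 ;;
     RStore 21 7 ;; DAdd 21 21 2 ;;
     RSub 0 8 7 ;; RStore 21 0 ;; DAdd 21 21 2).

Lemma wp_table S N ws s (rs : ready u S N ws s) :
  wp u table_prog (14 * 2 ^ (digits u S - 2) + 16)
    (fun s' => [/\ ready u S N ws s',
       forall j, j < S + N + 4 -> rm s' j = rm s j
     & dense_grid u S (fun i => rm s' (S + N + i))]) s.
Proof.
case: s rs => d r m v rs; have [[/= [d0 d1 d2 d10 d12] em] [d4 d5 d8]] := rs.
set X := digits u S in d4 d5 *; set K := (2 ^ (X - 2)).-1.
have K1 : 2 ^ (X - 2) = K.+1 by rewrite prednK ?expn_gt0.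
have KX : 2 ^ X = 4 * K.+1.
  rewrite -K1 (_ : X = (X - 2).+2) ?expnS //; last by rewrite /X /digits; lia.
  by rewrite mulnA (_ : (X - 2).+2 - 2 = X - 2) //; lia.
apply: (@wp_le _ _ _ ((K * 14 + 2) + 13)).
  by rewrite K1; lia.
rewrite addnC.
do 5!exe; apply: wp_op_seq => // e1 he1; rewrite /effect ?updE /=.
apply: wp_op_seq => // e2 he2; rewrite /effect ?updE /=.
apply: wp_op_seq => // e3 he3; rewrite /effect ?updE /=.
do 5!exe.
set qa := ((_%:R + _) * _)%R; set qb := ((_%:R - _) * _)%R.
have Hq (us : (u <= 100%:R^-1)%R) := grid_ratios u_gt0 us he1 he2 he3.
rewrite d2 in qa qb *; rewrite -/qa -/qb in Hq.
pose TB := S + N.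
pose I k (s' : memory R) := [/\ ready u S N ws s',
  [/\ dr s' 21 = TB + 4 * k.+1, dr s' 22 = TB + 2 ^ X, rr s' 8 = 0%R,
      rr s' 4 = qa & rr s' 5 = qb],
  forall j, j < TB + 4 -> rm s' j = v j
  & (u <= 100%:R^-1)%R ->
      grid u (fun i => rm s' (TB + i)) k (rr s' 6) (rr s' 7)].
apply: wp_impl (wp_while (I := I) _ _ _) _.
(* Before the first round [a] and [b] are both 1, and the interval to be covered is empty. *)
- rewrite /I /= d8 d4 d10; split=> //.
  rewrite /grid ?updE /= !expr0 mulr1; split=> // t /andP[l1 l2].
  by move: (lt_trans l1 l2); rewrite ltxx.
- move=> k [d' r' m' v'] lt [rd [/= f21 f22 g8 g4 g5] fr cov].
  split; first by rewrite f21 f22 KX ltn_add2l ltn_pmul2l.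
  apply: wp_op_seq => // a1 ha1; rewrite /effect ?updE /=.
  apply: wp_op_seq => // a2 ha2; rewrite /effect ?updE /=.
  do 2!exe.
  apply: wp_op_seq => // a3 ha3; rewrite /effect ?updE /=.
  do 4!exe.
  apply: wp_op_seq => // a4 ha4; rewrite /effect ?updE /=.
  exe; exe1.
  have [[_ _ rd2 _ _] _] := rd.1; rewrite /= in rd2.
  rewrite f21 rd2 g8 g4 g5 !addn1.
  set P := TB + 4 * k.+1.
  set a' := (_ * qa * _)%R; set b' := (_ * qb * _)%R.
  have EP : TB + 4 * k.+2 = P.+4 by rewrite /P [4 * k.+2]mulnS addnCA add4n.
  have n1 : (P == P.+1) = false by rewrite ltn_eqF.
  have n2 : (P == P.+2) = false by rewrite ltn_eqF // leqW.
  have n3 : (P == P.+3) = false by rewrite ltn_eqF // ltnS leqW.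
  split.
  + by apply: ready_frame rd _ _; rewrite //= ?updE /= ?eqxx.
  + by split; rewrite /= ?updE.
  + move=> j lej; have lejP : j < P.
      by apply: leq_trans lej _; rewrite leq_add2l leq_pmulr.
    by rewrite /= ?updE !ltn_eqF 1?leqW 1?leqW 1?leqW ?fr.
  move=> us; have [qa1 qb1] := Hq us.
  apply: (grid_step u_gt0 us qa1 qb1 ha1 ha2 ha3 ha4) (cov us) => /=.
  + move=> i lti; have lt' : TB + i < P by rewrite ltn_add2l.
    by rewrite ?updE !ltn_eqF 1?leqW 1?leqW 1?leqW.
  + by rewrite -/P ?(updE, eqxx, n1, n2, n3).
  + by rewrite ?(updE, addnS, eqSS, eqxx, n1, n2).
  + by rewrite ?(updE, addnS, eqSS, eqxx, n1).
  + by rewrite ?(updE, addnS, eqSS, eqxx).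
- by move=> s' [_ [-> -> _ _ _] _ _]; rewrite KX.
move=> s' [? _ ? H]; split=> // us t; rewrite KX.
by apply: grid_covered (H us).
Qed.
End Table.

(** * Evaluating the circuit *)

Section EvalGates.
Variable R : realType.
Implicit Types (y vals : seq R) (e : nat -> R) (gs : seq (gate R)).

Lemma size_eval_gates y e j vals gs :
  size (eval_gates y e j vals gs) = size vals + size gs.
Proof.
elim: gs j vals => [|g gs IH] j vals /=; first by rewrite addn0.
by rewrite IH size_rcons addSnnS.
Qed.

(** [eval_gates] recurses from the head of the list, whereas the loop invariant grows at its end. *)
Lemma eval_gates_rcons y e j vals gs g :
  let vs := eval_gates y e j vals gs in
  eval_gates y e j vals (rcons gs g) =
  rcons vs (gate_val y (e (size vs)) (j + count (@is_input R) gs) vs g).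
Proof.
elim: gs j vals => [|h gs IH] j vals /=; first by rewrite addn0.
by rewrite IH addnA.
Qed.

Lemma eq_eval_gates y e e' j vals gs :
  (forall k, k < size vals + size gs -> e k = e' k) ->
  eval_gates y e j vals gs = eval_gates y e' j vals gs.
Proof.
elim: gs j vals => [//|g gs IH] j vals /= H.
rewrite H ?addnS ?ltnS ?leq_addr //.
by apply: IH => k; rewrite size_rcons addSnnS; apply: H.
Qed.

(** The error of the new gate is known only when the machine executes it; no earlier gate reads
    position [size gs], so that entry can be set afterwards. *)
Lemma eval_gates_extend y e (eps d : R) gs g : roundoff eps e ->
  (`|d| < eps)%R ->
  let vs := eval_gates y e 0 [::] gs in
  exists2 e', roundoff eps e' &
    eval_gates y e' 0 [::] (rcons gs g) =
    rcons vs (gate_val y d (count (@is_input R) gs) vs g).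
Proof.
move=> re hd; exists (upd e (size gs) d).
  by move=> k; rewrite updE; case: eqP.
rewrite eval_gates_rcons size_eval_gates add0n updE eqxx.
congr rcons; last congr gate_val; apply: eq_eval_gates => k /=;
  by rewrite add0n updE => /ltn_eqF->.
Qed.
End EvalGates.

Ltac compare := exe; apply: wp_iflt => //= _.

(** * Executing a single gate *)

Section Gate.
Variables (R : realType) (u : R).
Hypothesis u_gt0 : (0 < u)%R.

(** Repeated subtraction. The dividend is stored plus one, so that the strict test of the machine
    decides a weak inequality. *)
Definition divide : cmd R :=
  DConst 11 0 ;; While 4 19 (DSub 19 19 4 ;; DAdd 11 11 2).

Lemma wp_divide d r m v z : d 19 = z.+1 -> d 2 = 1 -> 0 < d 4 ->
  wp u divide (z * 4 + 3)
    (fun s' => [/\ dr s' 19 = (z %% d 4).+1, dr s' 11 = z %/ d 4,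
        forall x, x \notin [:: 11; 19] -> dr s' x = d x, dm s' = m & rm s' = v])
    (Memory d r m v).
Proof.
move=> dz d2 K0; set K := d 4 in K0 *.
apply: (@wp_le _ _ _ (z %/ K * 4 + 2).+1).
  by move: (leq_div z K); lia.
exe; pose I k (s' : memory R) :=
  [/\ dr s' 19 = (z - k * K).+1, dr s' 11 = k,
   forall x, x \notin [:: 11; 19] -> dr s' x = d x, dm s' = m & rm s' = v].
apply: wp_impl (wp_while (I := I) _ _ _) _.
- rewrite /I /= ?updE /= mul0n subn0; split=> // x.
  by rewrite !inE negb_or updE => /andP[/negPf->].
- move=> k [d' r' m' v'] lt [/= e19 e11 ex -> ->].
  have e4 : d' 4 = K by rewrite ex.
  have e2 : d' 2 = 1 by rewrite ex.
  have le : k * K + K <= z.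
    by rewrite -mulSnr (leq_trans _ (leq_divM z K)) // leq_mul2r lt orbT.
  split; first by rewrite e4 e19; move: (k * K) le => q; lia.
  exe; exe1; rewrite /I /= ?updE /= e19 e4 e11 e2 addn1; split=> //.
    by rewrite mulSnr; move: (k * K) le => q; lia.
  move=> x xn; rewrite -ex //; move: xn.
  by rewrite !inE negb_or ?updE => /andP[/negPf-> /negPf->].
- move=> s' [-> _ -> // _ _]; rewrite -/K {1}(divn_eq z K) addKn.
  by rewrite ltn_mod.
by move=> s' [e19 ? ? ? ?]; split=> //; rewrite e19 {1}(divn_eq z K) addKn.
Qed.

(* Register 19 holds z + 1; the least significant digit of z in base K selects
   the grid value of the next input. *)
Definition load_input : cmd R :=
  divide ;; DAdd 17 8 19 ;; DSub 17 17 2 ;; RLoad 0 17 ;; DAdd 19 11 2.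

Definition load_const : cmd R := RLoad 0 14 ;; DAdd 14 14 2.

Definition select : cmd R :=
  DLoad 17 13 ;; DAdd 17 17 1 ;; RLoad 3 17 ;; DAdd 13 13 2 ;;
  IfNeg 1 (RMove 0 2) (RMove 0 3).

Definition load_parents : cmd R :=
  DLoad 17 13 ;; DAdd 17 17 1 ;; RLoad 1 17 ;; DAdd 13 13 2 ;;
  DLoad 17 13 ;; DAdd 17 17 1 ;; RLoad 2 17 ;; DAdd 13 13 2.

(** Before a division the result is set to 0, the value of [ap] when the zero test fails. A
    selection finds its first two parents already loaded. *)
Definition operate : cmd R :=
  DConst 7 3 ;; IfLt 16 7 (RAdd 0 1 2) (
  DConst 7 4 ;; IfLt 16 7 (RSub 0 1 2) (
  DConst 7 5 ;; IfLt 16 7 (RMul 0 1 2) (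
  DConst 7 6 ;; IfLt 16 7 (ROfD 0 10 ;; Quot 0 1 2) select))).

Definition dispatch : cmd R :=
  DLoad 16 13 ;; DAdd 13 13 2 ;;
  IfLt 16 2 load_input (
  DConst 7 2 ;; IfLt 16 7 load_const (load_parents ;; operate)).

Definition eval_gate : cmd R := dispatch ;; RStore 15 0 ;; DAdd 15 15 2.

Definition kept : seq nat := [:: 0; 1; 2; 4; 5; 8; 10; 12; 9; 15; 20].

(** Only arithmetic gates commit an error here: inputs and constants carry theirs from the table and
    from the initial loading. *)
Definition dispatched (g : gate R) z (s s' : memory R) : Prop :=
  [/\ all (fun x => dr s' x == dr s x) kept, dm s' = dm s, rm s' = rm s,
      [/\ dr s' 13 = dr s 13 + size (gate_word g),
          dr s' 14 = dr s 14 + size (gate_const g)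
        & dr s' 19 = (if is_input g then z %/ dr s 4 else z).+1]
    & match g with
      | GInput => rr s' 0 = rm s (dr s 8 + z %% dr s 4)
      | GConst _ => rr s' 0 = rm s (dr s 14)
      | GArith o a b => exists2 d : R, (`|d| < u)%R &
          rr s' 0 =
            (ap o (rm s (a + dr s 1)%N) (rm s (b + dr s 1)%N) * (1 + d))%R
      | GSel x a b => rr s' 0 = if (rm s (x + dr s 1)%N < 0)%R
          then rm s (a + dr s 1) else rm s (b + dr s 1)
      end].

Lemma wp_dispatch (g : gate R) z s :
  dr s 2 = 1 -> dr s 10 = 0 -> 0 < dr s 4 -> dr s 19 = z.+1 ->
  (forall i, i < size (gate_word g) ->
    dm s (dr s 13 + i) = nth 0 (gate_word g) i) ->
  wp u dispatch (4 * z + 36).+4 (dispatched g z s) s.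
Proof.
case: s => d r m v /= d2 d10 K0 d19 W.
have W0 : m (d 13) = nth 0 (gate_word g) 0.
  by rewrite -[d 13]addn0 W //; case: (g).
exe; exe; rewrite W0 d2.
case: g W W0 => [|c|o a b|x a b] W W0.
- apply: wp_iflt => /=; rewrite d2 // => _.
  apply: (@wp_le _ _ _ (z * 4 + 3 + 4)); first by lia.
  apply: wp_seq; apply: wp_impl.
    by apply: wp_divide; rewrite /=; first exact: d19.
  move=> [d' r' m' v'] /= []; move=> e19 e11 ex -> ->.
  exe; exe; exe; exe1; split=> //=.
  + by rewrite /= ?updE /= !ex //= ?eqxx.
  + by rewrite e11 !ex // ?updE /= d2 addn0 !addn1.
  + by rewrite e19 !ex // ?updE /= d2 addnS subn1.
- apply: wp_iflt => /=; rewrite d2 // => _.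
  apply: (@wp_le _ _ _ 36); first by rewrite leq_addl.
  exe; apply: wp_iflt => /=; rewrite //= => _.
  exe; exe1; split=> //=; first by rewrite ?eqxx.
  by rewrite d2 d19.
- have W1 : m (d 13 + 1) = a by rewrite W; case: (o).
  have W2 : m (d 13 + 1 + 1) = b by rewrite -addnA W; case: (o).
  have -> : nth 0 (gate_word (@GArith R o a b)) 0 = op_tag o by case: (o).
  have t1 : (op_tag o < 1) = false by case: (o).
  have t2 : (op_tag o < 2) = false by case: (o).
  apply: wp_iflt => /=; rewrite d2 t1 // => _.
  apply: (@wp_le _ _ _ 36); first by rewrite leq_addl.
  exe; apply: wp_iflt => /=; rewrite t2 // => _.
  apply: (@wp_seq _ _ _ _ 8 25).
  exe; exe; exe; exe; exe; exe; exe; exe1; rewrite ?d2 W1 W2.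
  have fin w : dispatched (@GArith R o a b) z (Memory d r m v) w <->
      [/\ all (fun x => dr w x == d x) kept, dm w = m, rm w = v,
       [/\ dr w 13 = d 13 + 1 + 1 + 1, dr w 14 = d 14 & dr w 19 = z.+1]
       & exists2 e : R, (`|e| < u)%R &
          rr w 0 = (ap o (v (a + d 1)%N) (v (b + d 1)%N) * (1 + e))%R].
    by rewrite /dispatched /= addn0 -!addnA.
  case: (o) fin => fin; repeat compare.
  + apply: wp_op => // e he; apply/fin; split; rewrite /= ?eqxx //.
    by exists e.
  + apply: wp_op => // e he; apply/fin; split; rewrite /= ?eqxx //.
    by exists e.
  + apply: wp_op => // e he; apply/fin; split; rewrite /= ?eqxx //.
    by exists e.
  exe; rewrite d10; apply: wp_quot => /= [v0|e he v0]; apply/fin.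
    split; rewrite /= ?eqxx //; exists 0%R.
      by rewrite normr0.
    by rewrite v0 eqxx mul0r.
  split; rewrite /= ?eqxx //; exists e => //.
  by rewrite /= ifN.
- have W1 : m (d 13 + 1) = x by rewrite W.
  have W2 : m (d 13 + 1 + 1) = a by rewrite -addnA W.
  have W3 : m (d 13 + 1 + 1 + 1) = b by rewrite -!addnA W.
  apply: wp_iflt => /=; rewrite d2 // => _.
  apply: (@wp_le _ _ _ 36); first by rewrite leq_addl.
  exe; apply: wp_iflt => /=; rewrite //= => _.
  apply: (@wp_seq _ _ _ _ 8 25).
  exe; exe; exe; exe; exe; exe; exe; exe1; rewrite ?d2 W1 W2.
  repeat compare.
  exe; exe; exe; exe; rewrite W3.
  apply: wp_ifneg => /= h; exe1.
    by split; rewrite /= ?eqxx ?d2 ?d19 ?h ?addn0 -?addnA.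
  by split; rewrite /= ?eqxx ?d2 ?d19 ?(negPf h) ?addn0 -?addnA.
Qed.
End Gate.

Lemma nth_flatten_map (A T : Type) (f : A -> seq T) (a0 : A) (x0 : T) gs k i :
  k < size gs -> i < size (f (nth a0 gs k)) ->
  size (flatten (map f (take k gs))) + i < size (flatten (map f gs)) /\
  nth x0 (flatten (map f gs)) (size (flatten (map f (take k gs))) + i) =
  nth x0 (f (nth a0 gs k)) i.
Proof.
move=> ltk lti.
have -> : flatten (map f gs) = flatten (map f (take k gs)) ++
    f (nth a0 gs k) ++ flatten (map f (drop k.+1 gs)).
  by rewrite -{1}(cat_take_drop k gs) (drop_nth a0 ltk) map_cat flatten_cat.
rewrite 2!size_cat ltn_add2l ltn_addr //.
by rewrite nth_cat ltnNge leq_addr /= addKn nth_cat lti.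
Qed.

(** * One pass through the gates as an approximate evaluation *)

Section Circuit.
Variables (R : realType) (u : R) (C : circuit R) (e0 : nat -> R).
Hypotheses (u_gt0 : (0 < u)%R) (re0 : roundoff u e0) (acC : acyclic C).
Local Notation gs := (gates C).
Local Notation GInput := (@GInput R).

Definition word := out C :: flatten (map (@gate_word R) gs).
Definition consts := flatten (map (@gate_const R) gs).

Variable S : nat.
Hypothesis gsS : size gs <= S.
Local Notation N := (size consts).
Local Notation K := (2 ^ digits u S).

(** The base [K] digits of [z] are the table indices of the inputs; the grid point is viewed as a
    perturbation of [y]. *)
Definition approximates (G : nat -> R) z (eps : R) (y : seq R) :=
  forall j, j < ninputs C -> exists2 d : R, (`|d| < eps)%R &
    G ((z %/ K ^ j) %% K) = (y`_j * (1 + d))%R.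

Definition loaded (G : nat -> R) (s : memory R) :=
  [/\ ready u S N word s,
      forall j, j < N -> rm s j = (consts`_j * (1 + e0 j))%R
    & forall i, i < K -> rm s (S + N + i) = G i].

(** By the last clause, one and the same run is an [eps]-evaluation at every [y] of which the grid
    point is an [eps]-perturbation. *)
Definition at_gate (G : nat -> R) z flag k (s : memory R) :=
  [/\ loaded G s,
      [/\ dr s 13 = S + 1 + size (flatten (map (@gate_word R) (take k gs))),
          dr s 14 = size (flatten (map (@gate_const R) (take k gs))),
          dr s 15 = N + k
        & dr s 19 = (z %/ K ^ count (@is_input R) (take k gs)).+1],
      dr s 9 = z /\ dr s 20 = flag
    & forall (y : seq R) (eps : R), (u <= eps)%R -> approximates G z eps y ->
        exists2 e, roundoff eps e & forall i, i < k ->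
          rm s (N + i) = nth 0%R (eval_gates y e 0 [::] (take k gs)) i].

Lemma wp_eval_gate G z flag k s : k < size gs -> at_gate G z flag k s ->
  wp u (eval_gate R) (4 * z + 42) (at_gate G z flag k.+1) s.
Proof.
move=> ltk [[rd Ec EG] [e13 e14 e15 e19] [e9 e20] V].
have [[[d0 d1 d2 d10 d12] W] [d4 d5 d8]] := rd.
set g := nth GInput gs k; set zz := _ %/ _ in e19.
have Wg i : i < size (gate_word g) ->
    dm s (dr s 13 + i) = nth 0 (gate_word g) i.
  move=> lti; have [lt <-] := nth_flatten_map 0 ltk lti.
  by rewrite e13 -!addnA W.
have K0 : 0 < dr s 4 by rewrite d4 expn_gt0.
apply: (@wp_le _ _ _ ((4 * zz + 36).+4 + 2)).
  by rewrite -!addnS -addnA leq_add2r leq_mul2l leq_div.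
apply: wp_seq; apply: wp_impl; first exact: wp_dispatch d2 d10 K0 e19 Wg.
move=> [d r m v] [kp /= -> -> [f13 f14 f19] fv].
have {kp} fk x : x \in kept -> d x = dr s x by move/(allP kp)/eqP.
exe; exe1; rewrite fk // e15; split.
- split=> /=.
  + by apply: ready_frame rd _ _; rewrite //= !fk // !eqxx.
  + by move=> j ltj; rewrite updE ltn_eqF ?Ec // ltn_addr.
  (* There are at most [S] gates, so the node values, stored behind the constants, never reach the
     table. *)
  + move=> i lti; rewrite updE gtn_eqF ?EG //.
    by rewrite [S + N]addnC -addnA ltn_add2l ltn_addr // (leq_trans ltk).
- rewrite /= !(take_nth GInput ltk) !map_rcons !flatten_rcons !size_cat -cats1.
  rewrite f13 f14 f19 e13 e14 addnA !fk // d2.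
  split; rewrite ?addn1 ?addnS ?addn0 //.
  rewrite count_cat /= -/g addn0 d4 /zz; case: (is_input g) => /=.
    by rewrite addn1 expnSr divnMA.
  by rewrite addn0.
- by rewrite /= !fk.
move=> y eps ue ap; have [e re He] := V y eps ue ap.
have eps0 : (`|0 : R| < eps)%R by rewrite normr0 (lt_le_trans u_gt0).
set vs := eval_gates y e 0 [::] (take k gs) in He.
have sizevs : size vs = k by rewrite size_eval_gates size_takel // ltnW.
(* By acyclicity the parents precede the gate, so their values are already stored. *)
have He' p : p \in parents g -> rm s (p + dr s 1) = (vs`_p)%R.
  move=> pg; rewrite d1 addnC He //.
  by have /forallP/(_ (Ordinal ltk))/allP/(_ _ pg) := acC.
have {fv} [dl hd Er] : exists2 dl : R, (`|dl| < eps)%R &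
    r 0 = gate_val y dl (count (@is_input R) (take k gs)) vs g.
  have cnt : is_input g -> count (@is_input R) (take k gs) < ninputs C.
    move=> ig; rewrite /ninputs -{2}(cat_take_drop k gs) count_cat.
    by rewrite (drop_nth GInput ltk) /= -/g ig -addn1 leq_add2l.
  case Eg: g cnt fv He' => [|c|o a b|x a b] cnt fv Hp /=.
  + have [dl hd Ed] := ap _ (cnt isT).
    by exists dl => //; rewrite fv d8 d4 EG ?ltn_mod ?expn_gt0 // /zz Ed.
  + have lt0 : 0 < size (gate_const (nth GInput gs k)) by rewrite -/g Eg.
    have [ltc] := nth_flatten_map 0%R ltk lt0.
    rewrite -/g Eg addn0 -e14 /= in ltc * => Ecs.
    exists (e0 (dr s 14)); first exact: lt_le_trans (re0 _) ue.
    by rewrite fv Ec ?Ecs.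
  + case: fv => dl hd ->; exists dl; first exact: lt_le_trans hd ue.
    by rewrite !Hp ?inE ?eqxx ?orbT.
  + by exists 0%R => //; rewrite fv !Hp ?inE ?eqxx ?orbT.
have [e' re' Ee] := eval_gates_extend y (take k gs) g re hd.
exists e' => // i; rewrite ltnS leq_eqVlt (take_nth GInput ltk) Ee -/vs.
rewrite nth_rcons sizevs /= updE eqn_add2l => /predU1P[->|lti].
  by rewrite ltnn eqxx Er.
by rewrite lti ltn_eqF // He.
Qed.
End Circuit.

(** * Exhaustive search over the grid points *)

Section Search.
Variables (R : realType) (u : R) (C : circuit R) (e0 : nat -> R).
Hypotheses (u_gt0 : (0 < u)%R) (re0 : roundoff u e0) (acC : acyclic C).
Hypothesis outC : out C < size (gates C).
Variable S : nat.
Hypothesis gsS : size (gates C) <= S.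
Local Notation gs := (gates C).
Local Notation N := (size (consts C)).
Local Notation loaded := (loaded u C e0 S).
Local Notation approximates := (approximates u C S).

Definition eval_input : cmd R :=
  DAdd 13 0 2 ;; DConst 14 0 ;; DMove 15 1 ;; DAdd 19 9 2 ;;
  While 13 12 (eval_gate R) ;;
  DLoad 17 0 ;; DAdd 17 17 1 ;; RLoad 0 17 ;;
  IfNeg 0 Skip (DConst 20 1) ;; DAdd 9 9 2.

(** The actual output depends on the errors of the run; this relation records all that is used about
    it. *)
Definition possible (G : nat -> R) z (v : R) :=
  forall (y : seq R) (eps : R), (u <= eps)%R -> approximates G z eps y ->
    exists2 e, roundoff eps e &
      v = nth 0%R (eval_gates y e 0 [::] gs) (out C).

Lemma wp_eval_input G z flag s : loaded G s -> dr s 9 = z -> dr s 20 = flag ->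
  wp u eval_input (size gs * (4 * z + 42).+2 + 13)
    (fun s' => [/\ loaded G s', dr s' 9 = z.+1 & exists2 v, possible G z v &
       dr s' 20 = if (v < 0)%R then flag else 1]) s.
Proof.
case: s => d r m v [rd Ec EG] /= d9 d20.
have [[[/= d0 d1 d2 d10 d12] W] _] := rd.
apply: (@wp_le _ _ _ (size gs * (4 * z + 42).+2 + 2 + 7).+4); first by lia.
exe; exe; exe; exe.
apply: wp_seq; apply: wp_impl.
  apply: (@wp_while _ _ _ _ _ (4 * z + 42) _ (at_gate u C e0 S G z flag)).
  - split=> //=.
    + rewrite take0 /= d0 d1 d2 d9 expn0 divn1 !addn0 addn1.
      by split; rewrite ?addn1.
    + move=> y eps ue _; exists (fun=> 0%R) => // k.
      by rewrite normr0 (lt_le_trans u_gt0).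
  - move=> k s' ltk I; split; last exact: wp_eval_gate.
    have [[rd' _ _] [-> _ _ _] _ _] := I.
    have [[[_ _ _ _ ->] _] _] := rd'.
    have lt0 : 0 < size (gate_word (nth (@GInput R) gs k)) by case: (nth _ _ _).
    have [lt _] := nth_flatten_map 0 ltk lt0.
    by rewrite addn0 in lt; rewrite -addnA ltn_add2l /= add1n ltnS.
  move=> s' [[rd' _ _] [-> _ _ _] _ _]; have [[[_ _ _ _ ->] _] _] := rd'.
  by rewrite take_size /= -addnA add1n.
move=> [d' r' m' v'] [[rd' Ec' EG'] [_ _ _ _] [/= e9 e20] V].
have [[[/= f0 f1 f2 f10 f12] W'] _] := rd'.
have Wo : m' (d' 0) = out C by rewrite f0 -[S]addn0 W'.
exe; exe; exe; rewrite Wo f1.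
have po : possible G z (v' (out C + N)).
  move=> y eps ue /(V _ _ ue) [e re H]; exists e => //.
  by rewrite addnC H // take_size.
apply: (@wp_seq _ _ _ _ 3 1); apply: wp_ifneg => /= h.
  apply: wp_skip; exe1; split=> //=; first last.
  - by exists (v' (out C + N)) => //; rewrite h.
  by rewrite e9 f2 addn1.
exe1; exe1; split=> //=; first last.
- by exists (v' (out C + N)) => //; rewrite (negPf h).
by rewrite e9 f2 addn1.
Qed.

Definition search_prog : cmd R :=
  DConst 9 0 ;; DConst 20 0 ;; While 9 5 eval_input ;; DMove 0 20.

(** Two one-sided guarantees suffice: feasibility needs a single code with a certain outcome,
    infeasibility needs all codes. *)
Lemma wp_search G s : loaded G s ->
  let Z := 2 ^ digits u S ^ 2 in
  wp u search_prog (Z * (size gs * (4 * Z + 42).+2 + 13).+2 + 5)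
    (fun s' =>
      (forall z, z < Z -> (forall v, possible G z v -> (0 <= v)%R) ->
         dr s' 0 = 1) /\
      ((forall z v, possible G z v -> (v < 0)%R) -> dr s' 0 = 0)) s.
Proof.
case: s => d r m v ld Z; have [rd Ec EG] := ld.
apply: (@wp_le _ _ _ ((Z * (size gs * (4 * Z + 42).+2 + 13).+2 + 2 + 1).+2)).
  by rewrite -addnA -addnS -addnS.
exe; exe; pose I k s' := [/\ loaded G s', dr s' 9 = k,
  forall z, z < k -> (forall v, possible G z v -> (0 <= v)%R) -> dr s' 20 = 1
  & (forall z v, possible G z v -> (v < 0)%R) -> dr s' 20 = 0].
apply: wp_seq; apply: wp_impl.
  apply: (@wp_while _ _ _ _ _ (size gs * (4 * Z + 42).+2 + 13) _ I).
  - by split.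
  - move=> k s' ltk [ld' e9 good bad]; split.
      by have [[_ [_ -> _]] _ _] := ld'; rewrite e9.
    apply: (@wp_le _ _ _ (size gs * (4 * k + 42).+2 + 13)).
      by rewrite leq_add2r leq_mul2l !ltnS leq_add2r leq_mul2l (ltnW ltk) !orbT.
    apply: wp_impl; first exact: (wp_eval_input ld' e9 erefl).
    move=> s'' [ld'' e9' [w po e20]]; split; rewrite ?e20 //.
      move=> z; rewrite ltnS leq_eqVlt => /predU1P[->|ltz] H.
        by rewrite ltNge H.
      by rewrite (good z) // if_same.
    by move=> H; rewrite (H _ _ po) bad.
  by move=> s' [[[_ [_ -> _]] _ _] -> _ _].
move=> [d' r' m' v'] [/= _ _ good bad].
by exe1; split=> [z ltz|]; [apply: good|].
Qed.

End Search.

(** * The whole program *)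

Definition search_time S k n :=
  let X := 2 * k + S + 2 in let Z := 2 ^ X ^ 2 in
  (S * 9 + 7) + ((8 * X + 4 * X ^ 2 + 18) + ((14 * 2 ^ (X - 2) + 16) +
    (Z * (n * (4 * Z + 42).+2 + 13).+2 + 5))).

(** There are [Z] codes and at most [Z] gates, and a division by subtraction takes about [4 * Z]
    steps at most; the cubic total is dominated by [Z ^ 5], as [Z >= 16]. *)
Lemma search_time_le S N k n : n <= S ->
  search_time S k n <= arith_bound (S + N) k.
Proof.
move=> nS; rewrite /search_time /arith_bound.
set X := 2 * k + S + 2; set Z := 2 ^ X ^ 2; set x := S + N + k + 1.
have XX : X <= X ^ 2 by rewrite -mulnn leq_pmulr // /X; lia.
have Z1 : X ^ 2 < Z by rewrite ltn_expl.
have Z2 : 2 ^ (X - 2) <= Z by rewrite leq_exp2l //; lia.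
have Z3 : 16 <= Z.
  by rewrite (@leq_exp2l 2 4) // -[4]/(2 ^ 2) leq_exp2r // /X; lia.
have SX : S <= X by rewrite /X; lia.
(* As [X <= 2 * x], the exponent [5 * X ^ 2] is at most [20 * x ^ 2], below the [64 * x ^ 2] of
   [arith_bound]. *)
apply: (@leq_trans (Z ^ 5)); last first.
  rewrite -expnM leq_exp2l //.
  have : X <= 2 * x by rewrite /X /x; lia.
  by rewrite -(leq_sqr X) => le; rewrite !expnMn in le *; lia.
have : n <= Z by lia.
clearbody Z.
move: (2 ^ (X - 2)) (X ^ 2) XX Z1 Z2 => a b XX Z1 Z2 nZ.
have ZZ : 16 * Z <= Z ^ 2 by rewrite -mulnn leq_mul2r Z3 orbT.
have ZZZ : 256 * (Z * Z ^ 2) <= Z ^ 5.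
  rewrite -expnS (expnD Z 2 3) leq_mul2r -[256]/(16 ^ 2).
  by rewrite leq_exp2r // Z3 orbT.
have : Z * (n * (4 * Z + 42).+2 + 13).+2 <= Z * (Z * (4 * Z + 42).+2 + 13).+2.
  by rewrite leq_mul2l !ltnS leq_add2r leq_mul2r nZ !orbT.
have -> : Z * (Z * (4 * Z + 42).+2 + 13).+2 =
    4 * (Z * Z ^ 2) + 44 * Z ^ 2 + 15 * Z.
  by rewrite -mulnn; ring.
move: (Z * (_).+2) => c.
have Z4 : 16 * Z ^ 2 <= Z * Z ^ 2 by rewrite leq_mul2r Z3 orbT.
move: (Z * Z ^ 2) (Z ^ 2) (Z ^ 5) ZZ ZZZ Z4 => z3 z2 z5.
lia.
Qed.

Section Main.
Variables (R : realType) (u : R) (C : circuit R) (e0 : nat -> R).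
Hypotheses (u_gt0 : (0 < u)%R) (re0 : roundoff u e0) (wfC : wf_circuit C).
Local Notation S := (size (encode C).1).
Local Notation N := (size (encode C).2).

Definition solver_prog : cmd R :=
  parse_prog R ;; setup_prog R ;; table_prog R ;; search_prog R.

Lemma size_flatten_map_ge (A T : Type) (f : A -> seq T) s :
  (forall a, 0 < size (f a)) -> size s <= size (flatten (map f s)).
Proof.
move=> f0; elim: s => //= a s IH.
by rewrite size_cat -add1n leq_add.
Qed.

Lemma size_gates_encode : size (gates C) <= S.
Proof.
apply: (@leq_trans (size (word C))); last first.
  by apply: size_flatten_map_ge => n; rewrite size_rcons.
by rewrite ltnW // ltnS size_flatten_map_ge // => -[|c|[]|].
Qed.

Lemma wp_solver :
  wp u solver_prog (search_time S (kmach u) (size (gates C)))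
    (fun s => exists2 G : nat -> R,
      G 0 = 0%R /\ dense_grid u S G
      & (forall z, z < 2 ^ digits u S ^ 2 ->
          (forall v, possible u C S G z v -> (0 <= v)%R) -> dr s 0 = 1) /\
        ((forall z v, possible u C S G z v -> (v < 0)%R) -> dr s 0 = 0))
    (init_memory e0 (encode C)).
Proof.
have /and3P[acC outC _] := wfC.
rewrite /search_time -/(digits u S).
apply: wp_seq; apply: wp_impl; first by apply: (@wp_parse _ _ _ (word C)).
move=> s1 [ps1 rm1].
apply: wp_seq; apply: wp_impl; first exact: wp_setup ps1.
move=> s2 [rs2 rm2].
apply: wp_seq; apply: wp_impl; first exact: wp_table rs2.
move=> s3 [rs3 rm3 cov].
apply: wp_impl.
  apply: (@wp_search _ _ C e0 _ _ acC outC _ size_gates_encode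
    (fun i => rm s3 (S + N + i))) => //.
  split=> // j ltj; rewrite rm3; last by rewrite ltn_addr // ltn_addl.
  by rewrite rm2 rm1.
move=> s4 H4; exists (fun i => rm s3 (S + N + i)) => //; split=> //.
(* Entry 0 lies beyond the real input: it is the default 0 of the initial memory, which a relative
   error does not change. *)
rewrite rm3; last by rewrite ltn_add2l.
by rewrite rm2 rm1 /= nth_default ?mul0r // addn0 leq_addl.
Qed.
End Main.

(** * Condition numbers *)

Local Open Scope ring_scope.

Section Log2.
Variable R : realType.
Implicit Types (x u : R) (n : nat).

Let ln2_gt0 : 0 < ln 2 :> R.
Proof. by rewrite ln_gt0 // ltr1n. Qed.

Lemma log2_le x n : 0 < x -> (log2 x <= n%:R) = (x <= 2 ^+ n).
Proof.
move=> x0; rewrite /log2 ler_pdivrMr // -[RHS]ler_ln ?posrE ?exprn_gt0 //.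
by rewrite lnXn // mulr_natl.
Qed.

Lemma log2_ge0 x : 1 <= x -> 0 <= log2 x.
Proof. by move=> x1; apply: divr_ge0; [exact: ln_ge0|exact: ltW]. Qed.

Lemma ceil_log2_le x n : 1 <= x ->
  (`|Num.ceil (log2 x)| <= n)%N = (x <= 2 ^+ n).
Proof.
move=> x1; rewrite -log2_le ?(lt_le_trans ltr01) //.
have c0 : 0 <= Num.ceil (log2 x).
  by rewrite ceil_ge0 (lt_le_trans (ltrN10 _)) // log2_ge0.
by rewrite -lez_nat gez0_abs // ceil_le_int.
Qed.

Lemma kmach_le u n : 0 < u -> u < 1 -> (kmach u <= n)%N = (1 <= u * 2 ^+ n).
Proof.
move=> u0 u1; rewrite /kmach ceil_log2_le ?invf_ge1 ?(ltW u1) //.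
by rewrite -[u^-1]mulr1 ler_pdivrMl.
Qed.

End Log2.

Section Condition.
Variables (R : realType) (C : circuit R).
Implicit Types (y : (ninputs C).-tuple R) (e : nat -> R).

Let robust y : set R := [set eps : R | 0 <= eps < 1 /\
    forall e : nat -> R, roundoff eps e -> (0 <= Defs.eval e y) = (0 <= fC y)].

Let robust0 y : robust y 0.
Proof.
split; first by rewrite lexx ltr01.
(* No error sequence is strictly bounded by 0. *)
by move=> e /(_ 0%N); rewrite ltNge normr_ge0.
Qed.

Let has_sup_robust y : has_sup (robust y).
Proof.
split; first by exists 0; exact: robust0.
by exists 1 => eps [/andP[_ /ltW]].
Qed.

Lemma rho_eval_itv y : 0 <= rho_eval y <= 1.
Proof.
apply/andP; split.
  by apply: ub_le_sup (robust0 y); case: (has_sup_robust y).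
by apply: ge_sup; [exists 0; exact: robust0|move=> eps [/andP[_ /ltW]]].
Qed.

(** Below the supremum there is an admissible [eps'] above [eps], and it bounds the given sequence
    too. *)
Lemma rho_eval_correct y e eps : eps < rho_eval y -> roundoff eps e ->
  (0 <= Defs.eval e y) = (0 <= fC y).
Proof.
move=> lt re; have [|eps' [_ H] lt'] := sup_gt _ lt.
  by exists 0; exact: robust0.
by apply: H => n; apply: lt_trans (re n) lt'.
Qed.

Let rhos_feas := [set rho_eval y * 2 ^- mgtv y | y in @feas R C]%classic.

Let exp2N_itv n : 0 < (2 ^- n : R) <= 1.
Proof.
by rewrite invr_gt0 exprn_gt0 //= invf_le1 ?exprn_gt0 // exprn_ege1 // ler1n.
Qed.

Lemma rho_Bfeas_ge0 : 0 <= rho_Bfeas C.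
Proof.
rewrite /rho_Bfeas; case: asboolP => [[y fy]|_].
  apply: (@le_trans _ _ (rho_eval y * 2 ^- mgtv y)).
    have /andP[r0 _] := rho_eval_itv y.
    by have /andP[/ltW p0 _] := exp2N_itv (mgtv y); rewrite mulr_ge0.
  apply: ub_le_sup; last by exists y.
  exists 1 => _ [z _ <-]; have /andP[h1 h2] := rho_eval_itv z.
  by have /andP[h3 h4] := exp2N_itv (mgtv z); rewrite mulr_ile1 // ltW.
pose y0 : (ninputs C).-tuple R := [tuple 0 | _ < ninputs C].
apply: lb_le_inf; first by exists (rho_eval y0); exists y0.
by move=> _ [y _ <-]; case/andP: (rho_eval_itv y).
Qed.

Hypothesis wfC : wf_circuit C.
Local Notation sz := (isize (CircBFeas R) (encode C)).

Hypothesis fin : (cond (CircBFeas R) (encode C) < +oo)%E.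

(** Finiteness of the condition excludes the value 0, whose inverse is [+oo]; otherwise the size
    dominates the logarithm of the inverse. *)
Lemma rho_Bfeas_ge_size : 2 ^- sz <= rho_Bfeas C.
Proof.
have r0 := rho_Bfeas_ge0.
rewrite /isize /=; move: fin; rewrite /= CircBFeas_condE // /mu_Bfeas.
have [->|rn0] := eqVneq (rho_Bfeas C) 0.
  by rewrite inve0 maxey ltxx.
rewrite inver (negPf rn0) -EFin_max /= => _.
have rp : 0 < rho_Bfeas C by rewrite lt_neqAle eq_sym rn0.
set c := Num.max _ _.
have c1 : 1 <= c by rewrite le_max lexx.
have := ceil_log2_le `|Num.ceil (log2 c)|%N c1; rewrite leqnn => /esym cle.
rewrite invf_ple ?posrE ?exprn_gt0 //.
apply: le_trans (_ : c <= _); first by rewrite le_max lexx orbT.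
by apply: le_trans cle _; rewrite ler_eXn2l ?ltr1n // leq_addl.
Qed.

(** The supremum need not be attained, which costs one bit. Both factors of
    [rho_eval y * 2 ^- mgtv y] are at most 1, so each one exceeds any bound that the product
    exceeds. *)
Lemma feas_witness : (@feas R C !=set0)%classic ->
  exists y, [/\ 0 <= fC y, 2 ^- sz.+1 < rho_eval y & (mgtv y <= sz)%N].
Proof.
move=> fe; have := rho_Bfeas_ge_size; rewrite /rho_Bfeas asboolT // => le_s.
have p0 : 0 < 2 ^- sz.+1 :> R by case/andP: (exp2N_itv sz.+1).
have [||_ [y fy <-] lt] := @sup_gt _ rhos_feas (2 ^- sz.+1).
- by case: fe => y fy; exists (rho_eval y * 2 ^- mgtv y); exists y.
- apply: lt_le_trans le_s; rewrite ltf_pV2 ?posrE ?exprn_gt0 //.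
  by rewrite ltr_eXn2l ?ltr1n.
have /andP[h1 h2] := rho_eval_itv y; have /andP[h3 h4] := exp2N_itv (mgtv y).
exists y; split => //.
  by apply: lt_le_trans lt _; rewrite ler_piMr.
have : 2 ^- sz.+1 < 2 ^- mgtv y :> R.
  by apply: lt_le_trans lt _; rewrite ler_piMl // ltW.
by rewrite ltf_pV2 ?posrE ?exprn_gt0 // ltr_eXn2l ?ltr1n.
Qed.

Lemma rho_eval_ge_size y :
  ~ (@feas R C !=set0)%classic -> 2 ^- sz <= rho_eval y.
Proof.
move=> nfe; apply: le_trans rho_Bfeas_ge_size _; rewrite /rho_Bfeas asboolF //.
apply: ge_inf; last by exists y.
by exists 0 => _ [z _ <-]; case/andP: (rho_eval_itv z).
Qed.
End Condition.

(** * Correctness of the search *)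

Lemma digits_exist (K m : nat) (f : nat -> nat) : (forall j, f j < K)%N ->
  exists2 z, (z < K ^ m)%N & forall j, (j < m)%N -> ((z %/ K ^ j) %% K = f j)%N.
Proof.
move=> fK; elim: m f fK => [|m IH] f fK; first by exists 0%N.
have [z lz Hz] := IH (f \o S) (fun j => fK j.+1).
have K0 : (0 < K)%N by apply: leq_ltn_trans (fK 0%N).
exists (z * K + f 0%N)%N.
  rewrite expnSr (leq_trans (_ : _ < z.+1 * K)%N) ?mulSnr ?ltn_add2l //.
  by rewrite -mulSnr leq_mul2r lz orbT.
case=> [|j] ltj; first by rewrite expn0 divn1 modnMDl modn_small.
by rewrite expnS divnMA divnMDl // (divn_small (fK 0%N)) addn0 Hz.
Qed.

(** Bernoulli's inequality. *)
Lemma le_1DMn (R : realDomainType) n (x : R) :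
  0 <= x -> 1 + n%:R * x <= (1 + x) ^+ n.
Proof.
move=> x0; elim: n => [|n IH]; first by rewrite mul0r addr0.
have n0 : 0 <= n%:R * x by rewrite mulr_ge0.
rewrite exprS -natr1.
apply: (@le_trans _ _ ((1 + x) * (1 + n%:R * x))); first nra.
by rewrite ler_wpM2l // addr_ge0.
Qed.

Lemma lt2_exp (R : realDomainType) n (x : R) :
  0 < x -> 1 <= x * n%:R -> 2 < (1 + 5%:R * x) ^+ n.
Proof. by move=> x0; have := @le_1DMn _ n (5%:R * x); nra. Qed.

Section Correctness.
Variables (R : realType) (u : R) (C : circuit R).
Hypotheses (u_gt0 : 0 < u) (u_lt1 : u < 1) (wfC : wf_circuit C).
Local Notation S := (size (encode C).1).
Local Notation X := (digits u S).
Local Notation sz := (isize (CircBFeas R) (encode C)).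
Hypothesis fin : (cond (CircBFeas R) (encode C) < +oo)%E.
Hypothesis prec : (prec_bound sz <= kmach u)%N.

Lemma roundoff_bound : u * 2 ^+ (sz + 9) < 1.
Proof.
by rewrite ltNge -kmach_le // -ltnNge; move: prec; rewrite /prec_bound addnS.
Qed.

Lemma roundoff_small : u <= 100%:R^-1.
Proof.
have : u * 2 ^+ 9 <= u * 2 ^+ (sz + 9).
  by rewrite ler_wpM2l ?(ltW u_gt0) // ler_eXn2l ?ltr1n // leq_addl.
move=> /le_lt_trans/(_ roundoff_bound).
have -> : 2 ^+ 9 = 512%:R :> R by rewrite -natrX.
have := u_gt0; lra.
Qed.

Lemma roundoff_fine : 16 * u < 2 ^- sz.+1.
Proof.
rewrite -[ltRHS]mul1r ltr_pdivlMr ?exprn_gt0 //.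
apply: le_lt_trans roundoff_bound.
rewrite [16 * u]mulrC -mulrA ler_wpM2l ?(ltW u_gt0) //.
have -> : 16 = 2 ^+ 4 :> R by rewrite -natrX.
by rewrite -exprD ler_eXn2l ?ltr1n // addnC; lia.
Qed.

Lemma roundoff_lt : u < 2 ^- sz.+1.
Proof.
by apply: le_lt_trans roundoff_fine; rewrite ler_peMl ?(ltW u_gt0) // ler1n.
Qed.

(** From [u * 2 ^+ kmach u >= 1] the power [2 ^ kmach u] of [1 + 5 * u] exceeds 2; it is raised to
    the power [2 ^ k.+1]. The exponent fits because [k <= sz < kmach u]. *)
Lemma grid_range k : (k <= sz)%N ->
  2 ^+ (2 ^ k.+1) < (1 + 5%:R * u) ^+ (2 ^ (X - 2)).-1.
Proof.
move=> ksz; have u0 := u_gt0; set q := 1 + 5%:R * u.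
have q1 : 1 <= q by rewrite lerDl mulr_ge0 // ltW.
have q2 : 2 < q ^+ (2 ^ kmach u) by rewrite lt2_exp // natrX -kmach_le.
apply: (@lt_le_trans _ _ (q ^+ (2 ^ (kmach u + k.+1)))).
  rewrite expnD exprM ltr_pXn2r ?nnegrE ?exprn_ge0 ?expn_gt0 //.
  by rewrite (le_trans ler01).
rewrite ler_weXn2l //.
have : (2 ^ (kmach u + k.+1) < 2 ^ (X - 2))%N.
  by rewrite ltn_exp2l // /digits; move: prec; rewrite /prec_bound; lia.
by rewrite -[(_ <= _.-1)%N]ltnS prednK ?expn_gt0.
Qed.

(** A nonzero [t] lies within the bounds of [grid_range]; 0 is relatively close only to itself and
    is entry 0. *)
Lemma grid_approx (G : nat -> R) (t : R) : G 0%N = 0 -> dense_grid u S G ->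
  (mgt t <= sz)%N ->
  exists2 i, (i < 2 ^ X)%N &
    exists2 d : R, `|d| < 2 ^- sz.+1 & G i = t * (1 + d).
Proof.
move=> G0 cov; rewrite /mgt.
case: ex_minnP => k /andP[_ /orP[/eqP ->|/andP[lo hi]]] _ ksz.
  exists 0%N; first by rewrite expn_gt0.
  by exists 0; rewrite ?normr0 ?mul0r // invr_gt0 exprn_gt0.
have big := grid_range ksz.
have t0 : 0 < `|t| by apply: lt_le_trans lo; rewrite invr_gt0 exprn_gt0.
have tn0 : t != 0 by rewrite -normr_gt0.
have [|i lti H] := cov roundoff_small t.
  apply/andP; split.
    apply: lt_le_trans lo; rewrite ltf_pV2 ?posrE ?exprn_gt0 //.
      apply: le_lt_trans big; rewrite ler_eXn2l ?ltr1n // leq_exp2l //.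
    by rewrite addr_gt0 // mulr_gt0.
  apply: le_lt_trans big; apply: le_trans hi _.
  apply: (@le_trans _ _ (2 ^+ (2 ^ k.+1 - 1))).
    rewrite ler_piMr ?exprn_ge0 // gerBl invr_ge0 exprn_ge0 //.
  by rewrite ler_eXn2l ?ltr1n // leq_subr.
exists i => //; exists ((G i - t) / t); last by field.
rewrite normrM normfV; apply: le_lt_trans roundoff_fine.
by rewrite ler_pdivrMr.
Qed.

Lemma ninputs_le : (ninputs C <= S)%N.
Proof. by apply: leq_trans (size_gates_encode C); apply: count_size. Qed.

(** Grid values close to the coordinates of the witness supply the digits of [z]; every output there
    is an evaluation at the witness with errors it tolerates. *)
Lemma feas_reached (G : nat -> R) : G 0%N = 0 -> dense_grid u S G ->
  (@feas R C !=set0)%classic ->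
  exists2 z, (z < 2 ^ X ^ 2)%N & forall v, possible u C S G z v -> 0 <= v.
Proof.
move=> G0 cov fe; have [y [fy rho mgy]] := feas_witness wfC fin fe.
have /fin_all_exists2[i lti Hi] (j : 'I_(ninputs C)) :
    exists2 i, (i < 2 ^ X)%N &
    exists2 d : R, `|d| < 2 ^- sz.+1 & G i = tnth y j * (1 + d).
  apply: grid_approx => //; apply: leq_trans mgy.
  by rewrite /mgtv (bigD1 j) //= leq_maxl.
pose f j := if insub j is Some j' then i j' else 0%N.
have [|z ltz Hz] := @digits_exist (2 ^ X) (ninputs C) f.
  by move=> j; rewrite /f; case: insubP => [j' _ _|_]; rewrite ?lti ?expn_gt0.
exists z.
  apply: leq_trans ltz _; rewrite -expnM leq_exp2l // -mulnn leq_mul2l.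
  by rewrite (leq_trans ninputs_le) ?orbT // /digits; lia.
move=> v /(_ y (2 ^- sz.+1)) [||e re ->].
- exact: ltW roundoff_lt.
- move=> j ltj; have [d hd Ed] := Hi (Ordinal ltj); exists d => //.
  by rewrite Hz // /f insubT Ed (tnth_nth 0).
by rewrite (rho_eval_correct rho re).
Qed.

(** The grid point itself is taken as [y]: its inputs carry no error, and in the infeasible case
    every point is well conditioned. *)
Lemma infeas_rejected (G : nat -> R) : ~ (@feas R C !=set0)%classic ->
  forall z v, possible u C S G z v -> v < 0.
Proof.
move=> nfe z v; pose y : (ninputs C).-tuple R :=
  [tuple G ((z %/ (2 ^ X) ^ j) %% 2 ^ X)%N | j < ninputs C].
move=> /(_ y u (lexx u)) [|e re ->].
  move=> j ltj; exists 0; first by rewrite normr0.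
  by rewrite -[y`_j](tnth_nth 0 y (Ordinal ltj)) tnth_mktuple addr0 mulr1.
have lt : u < rho_eval y.
  apply: lt_le_trans (rho_eval_ge_size wfC fin y nfe).
  apply: lt_trans roundoff_lt _.
  by rewrite ltf_pV2 ?posrE ?exprn_gt0 // ltr_eXn2l ?ltr1n.
rewrite ltNge (rho_eval_correct lt re); apply/negP => fy; apply: nfe.
by exists y.
Qed.

End Correctness.

(** * Cost bounds and membership in the class *)

Section Class.
Variable R : realType.

Lemma solver_solves :
  solves (compile 0 (solver_prog R)) (CircBFeas R) arith_bound prec_bound.
Proof.
move=> i fin u e0 e u0 u1 re0 re /=.
(* Inputs that are not codes of circuits have infinite condition. *)
have [C wfC Ei] : exists2 C, wf_circuit C & encode C = i.
  apply: contrapT => nC; move: fin; rewrite /= CircBFeas_cond_notin ?ltxx //.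
  by move=> C wfC Ei; apply: nC; exists C.
subst i.
have [hlt [s -> [G [G0 cov] [good bad]]]] :=
  wp_run (search_time_le (size (encode C).2) (kmach u) (size_gates_encode C)) re
    (wp_solver u0 re0 wfC).
split=> // pr; rewrite /accepts /=; split.
  move=> /eqP s1; exists C; split=> //; apply: contrapT => nfe.
  by move: s1; rewrite bad //; apply: (infeas_rejected u0 u1 wfC fin pr).
move=> [D [_ /encode_inj -> fe]].
have [z ltz H] := feas_reached u0 u1 wfC fin pr G0 cov fe.
by rewrite (good z).
Qed.

Lemma arith_bound_constructible : time_constructible2 R arith_bound.
Proof.
exists (compile 0 (arith_bound_prog R)), 32%N => n k u e0 e u0 u1 re0 re.
set w := nseq n true ++ false :: nseq k true.
have d0 : dr (init_memory e0 (w, [::])) 0 = (n + k + 1)%N.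
  by rewrite /= size_cat /= !size_nseq addnS addn1.
have H := @wp_arith_bound R u (init_memory e0 (w, [::])); rewrite d0 in H.
have [hlt [s Es Ed]] := wp_run (leqnn (32 * (arith_bound n k + 1))) re H.
by split; rewrite ?Es.
Qed.

Lemma prec_bound_constructible : time_constructible R prec_bound.
Proof.
exists (compile 0 (prec_bound_prog R)), 1%N => n u e0 e u0 u1 re0 re.
have le2 : (2 <= 1 * (prec_bound n + 1))%N by rewrite mul1n /prec_bound; lia.
have d0 : dr (init_memory e0 (nseq n true, [::])) 0 = n by rewrite /= size_nseq.
have H := @wp_prec_bound R u (init_memory e0 (nseq n true, [::])).
rewrite d0 in H; have [hlt [s Es Ed]] := wp_run le2 re H.
by split; rewrite ?Es.
Qed.

(** The output name and the first gate take at least one bit each. Size 2 lets a power of the size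
    absorb the constant 64. *)
Lemma size_encode_ge2 (C : circuit R) :
  wf_circuit C -> (2 <= size (encode C).1)%N.
Proof.
move=> /and3P[_ outC _]; rewrite /= size_cat size_rcons size_nseq.
set ws := flatten (map (@gate_word R) (gates C)).
have : (0 < size (flatten (map unary ws)))%N.
  apply: leq_trans (size_flatten_map_ge _ _); last first.
    by move=> n; rewrite size_rcons.
  apply: leq_trans (size_flatten_map_ge _ _); last by case=> [|c|[]|].
  exact: leq_trans outC.
lia.
Qed.

(** For [n >= 2], [8 * (2 * n + 11) <= 64 * n <= n ^ 7]; squaring gives the exponent 14. *)
Lemma arith_prec_bound L n : (L <= n)%N -> (2 <= n)%N ->
  (arith_bound L (prec_bound n) <= 2 ^ n ^ 14)%N.
Proof.
move=> Ln n2; rewrite /arith_bound leq_exp2l // (expnM n 7 2) leq_exp2r //.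
have : (8 * (L + prec_bound n + 1) <= 64 * n)%N by rewrite /prec_bound; lia.
move=> /leq_trans; apply; rewrite expnSr leq_mul2r.
by rewrite (@leq_exp2r 2 n 6) // n2 orbT.
Qed.

End Class.

Theorem theorem6p7 (R : realType) : EXP_ro_P (CircBFeas R).
Proof.
exists arith_bound, prec_bound; split.
- split; [exact: arith_bound_constructible|exact: prec_bound_constructible|].
  by eexists; exact: solver_solves.
- by exists 10%N, 1%N => n; rewrite /prec_bound expn1; lia.
exists 2, 14%:R; split=> [||i fin]; [by rewrite ltr1n|by []|].
rewrite powR_mulrn // -natrX powR_mulrn // -natrX ler_nat.
apply: arith_prec_bound; first exact: leq_addr.
apply: (@leq_trans (ilength i)); last exact: leq_addr.
have [C wfC <-] : exists2 C, wf_circuit C & encode C = i.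
  apply: contrapT => nC; move: fin; rewrite /= CircBFeas_cond_notin ?ltxx //.
  by move=> C wfC Ei; apply: nC; exists C.
by rewrite (leq_trans (size_encode_ge2 wfC)) // leq_addr.
Qed.
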